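(* Let $G$ be a finite supersolvable group whose Sylow $2$-subgroup is noncyclic. Then every connected Cayley graph $\mathrm{Cay}(G,X)$ on $G$ of valency at least four admits a nowhere-zero $3$-flow.
   Context: Graphs are finite, undirected and loopless, with parallel edges allowed. A $k$-flow in a graph $\Gamma$ is a pair $(D,\varphi)$ where $D$ is an orientation of $\Gamma$ (each edge, including each parallel edge, gets a direction) and $\varphi$ assigns an integer to each arc with $|\varphi(e)|<k$, such that at every vertex the sum of $\varphi$ over outgoing arcs equals the sum over incoming arcs; it is nowhere-zero if $\varphi(e)\neq 0$ for all arcs $e$. (Existence does not depend on the chosen orientation.) For a finite group $G$, a connection multiset is a multiset $X$ of elements of $G\setminus\{1\}$ with $X=X^{-1}$ such that each $x\in X$ and $x^{-1}$ have equal multiplicities; the Cayley graph $\mathrm{Cay}(G,X)$ has vertex set $G$, and the number of edges joining $g$ and $h$ equals the multiplicity of $g^{-1}h$ in $X$. Its valency is the cardinality of $X$ (counted with multiplicity). A group is supersolvable if it has a normal series $\{1\}=G_0\le G_1\le\cdots\le G_n=G$ with each $G_i$ normal in $G$ and each $G_i/G_{i-1}$ cyclic. *)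

(* Defs.v *)
From HB Require Import structures.
From mathcomp Require Import all_boot all_order all_algebra.
From mathcomp Require Import all_fingroup all_solvable.
From mathcomp Require Import finmap multiset.

Set Implicit Arguments.
Unset Strict Implicit.
Unset Printing Implicit Defensive.

Local Open Scope nat_scope.
Local Open Scope group_scope.
Local Open Scope mset_scope.

(* Finite loopless multigraphs: distinct edges may have the same ends. *)
Record multigraph := Multigraph {
  vertex : finType;
  edge : finType;
  ends : edge -> {set vertex};
  card_ends : forall e : edge, #|ends e| = 2 }.

Definition adjacent (Gamma : multigraph) : rel (vertex Gamma) :=
  [rel u v | [exists e : edge Gamma, ends e == [set u; v]]].

Definition connected (Gamma : multigraph) : Prop :=
  forall u v : vertex Gamma, connect (@adjacent Gamma) u v.

Record orientation (Gamma : multigraph) := Orientation {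
  arc_tail : edge Gamma -> vertex Gamma;
  arc_head : edge Gamma -> vertex Gamma;
  ends_orientation : forall e : edge Gamma, ends e = [set arc_tail e; arc_head e] }.

Definition is_flow (k : nat) (Gamma : multigraph) (D : orientation Gamma)
    (phi : edge Gamma -> int) : Prop :=
  (forall e, (`|phi e| < k%:Z)%R) /\
  (forall v, (\sum_(e | arc_tail D e == v) phi e
              = \sum_(e | arc_head D e == v) phi e)%R).

Definition has_nowhere_zero_flow (k : nat) (Gamma : multigraph) : Prop :=
  exists (D : orientation Gamma) (phi : edge Gamma -> int),
    is_flow k D phi /\ (forall e, phi e <> 0%R).

(* The multigraph on V with m u v edges joining u and v, for m symmetric.
   An unordered pair of distinct vertices is represented by the ordered pair
   that is increasing in the enumeration of V. *)
Section OfMultiplicity.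

Variables (V : finType) (m : V -> V -> nat).

Definition vpair := {p : V * V | enum_rank p.1 < enum_rank p.2}.

Definition mult_edge := {p : vpair & 'I_(m (val p).1 (val p).2)}.

Definition mult_ends (e : mult_edge) : {set V} :=
  [set (val (tag e)).1; (val (tag e)).2].

Lemma card_mult_ends (e : mult_edge) : #|mult_ends e| = 2.
Proof.
rewrite cards2; case: eqP => // eq12.
by have := valP (tag e); rewrite eq12 ltnn.
Qed.

Definition multigraph_of_mult : multigraph := Multigraph card_mult_ends.

Lemma card_edges_between :
    (forall u v, m u v = m v u) -> (forall u, m u u = 0) ->
  forall u v,
    #|[set e : edge multigraph_of_mult | ends e == [set u; v]]| = m u v.
Proof.
move=> mC m0 u v; wlog le_uv : u v / enum_rank u <= enum_rank v.
  move=> IH; case: (leqP (enum_rank u) (enum_rank v)) => [/IH//|/ltnW/IH].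
  by rewrite setUC mC => ->.
case: (eqVneq u v) => [<-|neq_uv].
  rewrite m0; apply/eqP; rewrite cards_eq0; apply/eqP/setP=> e; rewrite !inE.
  apply/negP=> /eqP eq_e; have := @card_ends multigraph_of_mult e.
  by rewrite eq_e setUid cards1.
have lt_uv : enum_rank (u, v).1 < enum_rank (u, v).2.
  rewrite ltn_neqAle le_uv andbT; apply: contra neq_uv.
  by move=> /eqP/val_inj/enum_rank_inj /= ->.
pose p : vpair := Sub (u, v) lt_uv.
pose f (i : 'I_(m (val p).1 (val p).2)) : mult_edge :=
  Tagged (fun p : vpair => 'I_(m (val p).1 (val p).2)) i.
have inj_f : injective f by move=> i j /eqP; rewrite eq_Tagged => /eqP.
rewrite -[RHS]card_ord -(card_imset predT inj_f).
apply: eq_card => -[[[a b] lt_ab] i]; rewrite inE; apply/eqP/imsetP.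
  rewrite /mult_ends /= => eq_ab.
  have: a \in [set u; v] by rewrite -eq_ab !inE eqxx.
  have: b \in [set u; v] by rewrite -eq_ab !inE eqxx orbT.
  rewrite !inE => /orP[]/eqP eqb /orP[]/eqP eqa; subst a b.
  - by exfalso; have := lt_ab; rewrite /= ltnn.
  - by exfalso; have := lt_ab; rewrite /= ltnNge le_uv.
  - move: lt_ab i {eq_ab} => lt_ab.
    by rewrite (bool_irrelevance lt_ab lt_uv) => i; exists i.
  - by exfalso; have := lt_ab; rewrite /= ltnn.
by case=> j _ ->.
Qed.

End OfMultiplicity.

Section Cayley.

Variables (gT : finGroupType) (G : {group gT}).

(* For X : {mset gT}, X x is the multiplicity of x in X. *)
Definition connection_multiset (X : {mset gT}) : Prop :=
  (forall x, x \in X -> x \in G^#) /\ (forall x, X x^-1 = X x).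

(* The vertex type is the subtype [subg G] of elements of G. *)
Definition Cayley (X : {mset gT}) : multigraph :=
  multigraph_of_mult (fun g h : [subg G] => X (sgval (g^-1 * h))).

Lemma card_Cayley_edges (X : {mset gT}) (g h : [subg G]) :
    connection_multiset X ->
  #|[set e : edge (Cayley X) | ends e == [set g; h]]| = X (sgval (g^-1 * h)).
Proof.
case=> XG XV; apply: (card_edges_between (m := fun g h => X (sgval (g^-1 * h)))).
  by move=> a b; rewrite -XV /= invMg invgK.
by move=> a; rewrite /= mulVg; apply/mset_eq0P/negP=> /XG; rewrite !inE eqxx.
Qed.

Definition supersolvable : Prop :=
  exists s : seq {group gT},
    [/\ all (fun H : {group gT} => H <| G) s,
        path (fun H K : {group gT} => (H \subset K) && cyclic (K / H)) 1%G s
      & last 1%G s = G].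

End Cayley.

(* Main.v *)
Require Import Defs.
From HB Require Import structures.
From mathcomp Require Import all_boot all_order all_algebra.
From mathcomp Require Import all_fingroup all_solvable.
From mathcomp Require Import finmap multiset.
From mathcomp Require Import zify ring.

(** By Tutte, it suffices to find a nowhere-zero Z/3-flow, that is, signs +-1 on
    the edges with zero net outflow mod 3. Every pair x, x^-1 and every pair of
    involutions of X carries such a flow, so X may be replaced by any subfamily
    with an odd number of involutions; we may thus assume that X itself has an
    odd number of them. A subfamily of valency 3 carries a flow as soon as it
    avoids a subgroup of index 2 of the group that it generates.

    A supersolvable G has a normal 2-complement N, and flows lift from G/N.

    If at least 5 elements of X lie outside N, one works in the 2-group G/N.
    Frattini quotients yield a subfamily of valency 3 as above, except when an
    involution z of X is a power of every x in X with x <> x^-1. For two such x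
    and y generating incomparable subgroups, {z, x^+-1, y^+-1} carries a flow in
    which at each vertex exactly one of the cycles through x and y switches
    direction; this is a system of linear equations mod 2 whose only obstruction
    is a parity.

    Otherwise three elements of X lie outside N, and again they carry a flow
    unless they are involutions a, b, c such that G/N is dihedral, generated by
    a and b, with c in <ab>. There is some y in X inside N, and after replacing
    G by a quotient <y> is normal of odd prime order. Modulo <y> the graph on
    a, b, c covers a Moebius ladder; it has a Z/3-flow that vanishes on few
    edges, and this flow is spread over the cosets of <y> so that it vanishes
    nowhere, using signs that alternate along the coset except at one place. *)

Set Implicit Arguments.
Unset Strict Implicit.
Unset Printing Implicit Defensive.

Import GRing.Theory.

Local Open Scope nat_scope.

(** * From Z/3-flows to integer flows *)

Section ModularFlows.

Import Order.TTheory Num.Theory.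

Variables (V E : finType) (tl hd : E -> V).
Implicit Types (psi : E -> int) (u v w : V).
Local Open Scope ring_scope.

Definition excess psi v : int := \sum_(e | tl e == v) psi e - \sum_(e | hd e == v) psi e.

Definition mod3_flow psi :=
  (forall e, psi e != 0 /\ `|psi e| < 3) /\ (forall v, exists k : int, excess psi v = 3 * k).

(** Changing the value on such an edge by 3, to the congruent value of opposite sign, moves 3 units
    of excess from [u] to [w]. *)
Definition residual psi : rel V := fun u w => [exists e,
  [&& tl e == u, hd e == w & 0 < psi e] || [&& tl e == w, hd e == u & psi e < 0]].

Definition imbalance psi : nat := (\sum_v `|excess psi v|%N)%N.

Lemma excess_update psi e0 (x : int) v :
  excess (fun e => if e == e0 then psi e + x else psi e) v =
  excess psi v + (if tl e0 == v then x else 0) - (if hd e0 == v then x else 0).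
Proof.
have upd (P : pred E) : \sum_(e | P e) (if e == e0 then psi e + x else psi e) =
    \sum_(e | P e) psi e + (if P e0 then x else 0).
  rewrite (eq_bigr (fun e => psi e + (if e == e0 then x else 0))); last first.
    by move=> e _; case: eqP; rewrite ?addr0.
  rewrite big_split /=; congr (_ + _); case: ifP => Pe0.
    rewrite (bigD1 e0) //= eqxx big1 ?addr0 // => e /andP[_ /negPf->] //.
  by rewrite big1 // => e Pe; case: eqP => // ee0; rewrite ee0 Pe0 in Pe.
by rewrite /excess !upd; ring.
Qed.

Lemma excess_sum psi (S : pred V) :
  \sum_(v | S v) excess psi v = \sum_e psi e * ((S (tl e))%:R - (S (hd e))%:R).
Proof.
rewrite /excess sumrB.
have part (f : E -> V) : \sum_(v | S v) \sum_(e | f e == v) psi e =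
    \sum_e psi e * (S (f e))%:R.
  rewrite (exchange_big_dep predT) //=; apply: eq_bigr => e _.
  rewrite big_mkcondr /= big_mkcond (bigD1 (f e)) //= eqxx big1 ?addr0.
    by case: (S _); rewrite ?mulr1 ?mulr0.
  by move=> v; rewrite eq_sym => /negPf->; case: ifP.
by rewrite !part -sumrB; apply: eq_bigr => e _; rewrite mulrBr.
Qed.

(** Only one edge changes and it is incident with [u], so residual arcs avoiding [u] survive; the
    remainder of a simple path stays usable. *)
Lemma push psi u w : mod3_flow psi -> residual psi u w -> exists psi',
  [/\ mod3_flow psi',
      forall v, excess psi' v = excess psi v + (if v == w then 3 else 0) - (if v == u then 3 else 0)
    & forall v v', v != u -> v' != u -> residual psi v v' -> residual psi' v v'].
Proof.
case=> psiP exP /existsP[e0 res].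
pose x : int := if 0 < psi e0 then -3 else 3.
pose psi' e := if e == e0 then psi e + x else psi e.
have xE v : excess psi' v =
    excess psi v + (if v == w then 3 else 0) - (if v == u then 3 else 0).
  rewrite excess_update /x; case/orP: res => /and3P[/eqP-> /eqP-> sgn].
    rewrite sgn ![_ == v]eq_sym; by case: (v == u) (v == w) => [] []; lia.
  have -> : (0 < psi e0) = false by rewrite ltNge ltW.
  by rewrite ![_ == v]eq_sym; case: (v == u) (v == w) => [] []; lia.
exists psi'; split=> //.
  split=> [e|v].
    have [n0 lt3] := psiP e; rewrite /psi' /x; case: (eqVneq e e0) => [ee|] //; subst e.
    have {res}: 0 < psi e0 \/ psi e0 < 0 by case/orP: res => /and3P[_ _]; [left|right].
    by move: (psi e0) n0 lt3 => z n0 lt3 sgn; case: ifP => sgn'; split; lia.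
  have [k ek] := exP v; rewrite xE ek.
  exists (k + (if v == w then 1 else 0) - (if v == u then 1 else 0)).
  by case: (v == u) (v == w) => [] []; lia.
move=> v v' nv nv' /existsP[e rese]; apply/existsP; exists e.
rewrite /psi'; case: (eqVneq e e0) => // ee; subst e.
case/orP: res => /and3P[/eqP E1 /eqP E2 _]; move: rese; rewrite E1 E2 ![u == _]eq_sym.
  by rewrite (negPf nv) (negPf nv') /= ?andbF.
by rewrite (negPf nv) (negPf nv') /= ?andbF.
Qed.

(** Push along the first arc. Excesses are multiples of 3, so if [v1] has negative excess the
    imbalance drops; otherwise it is unchanged, [v1] becomes positive, and the induction continues
    from [v1]. *)
Lemma augment p psi v0 : mod3_flow psi -> path (residual psi) v0 p -> uniq (v0 :: p) ->
    0 < excess psi v0 -> excess psi (last v0 p) < 0 ->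
  exists2 psi', mod3_flow psi' & (imbalance psi' < imbalance psi)%N.
Proof.
elim: p psi v0 => [|v1 p IHp] psi v0 fl /=; first by move=> _ _ h1 h2; lia.
case/andP=> res01 pathp /andP[nv0 uniqp] ex0 exl.
have [psi' [fl' exE resE]] := push fl res01.
have n01: v1 != v0 by apply: contraNneq nv0 => ->; rewrite mem_head.
have ge3: 3 <= excess psi v0 by have [k ek] := fl.2 v0; lia.
have e0: excess psi' v0 = excess psi v0 - 3.
  by rewrite exE eqxx eq_sym (negPf n01); lia.
have e1: excess psi' v1 = excess psi v1 + 3 by rewrite exE eqxx (negPf n01); lia.
have eo v : v != v0 -> v != v1 -> excess psi' v = excess psi v.
  by move=> n0 n1; rewrite exE (negPf n0) (negPf n1) addr0 subr0.
have imb: imbalance psi' = (absz (excess psi v0 - 3)%R + (absz (excess psi v1 + 3)%R +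
    \sum_(v | (v != v0) && (v != v1)) `|excess psi v|))%N.
  rewrite /imbalance (bigD1 v0) //= (bigD1 v1) //= e0 e1; congr (_ + (_ + _))%N.
  by apply: eq_bigr => v /andP[n0 n1]; rewrite eo.
have imb0: imbalance psi = (`|excess psi v0| + (`|excess psi v1| +
    \sum_(v | (v != v0) && (v != v1)) `|excess psi v|))%N.
  by rewrite /imbalance (bigD1 v0) //= (bigD1 v1).
have [lt0|ge0] := ltP (excess psi v1) 0.
  exists psi' => //; rewrite imb imb0.
  have le3: excess psi v1 <= -3 by have [k ek] := fl.2 v1; lia.
  move: (excess psi v0) (excess psi v1) ge3 le3 => a b; clear; lia.
have eqimb: imbalance psi' = imbalance psi.
  rewrite imb imb0; move: (excess psi v0) (excess psi v1) ge3 ge0 => a b; clear; lia.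
have nl0: last v1 p != v0 by apply: contraNneq nv0 => <-; apply: mem_last.
have nl1: last v1 p != v1.
  by apply: contraTneq exl => ->; rewrite -leNgt.
have path' : path (residual psi') v1 p.
  apply: (sub_in_path (P := predC1 v0)) pathp.
    by move=> v v' /= nv nv'; apply: resE.
  by apply/allP=> v inv /=; apply: contraNneq nv0 => <-.
have [||psi2 fl2 lt2] := IHp psi' v1 fl' path' uniqp; last by exists psi2; rewrite -?eqimb.
  by rewrite e1 ltr_wpDl.
by rewrite eo.
Qed.

(** Augment until every excess vanishes. If no vertex of negative excess were reachable from a
    positive [v0], the reachable set [S] would have positive total excess; but every edge between
    [S] and its complement carries flow into [S], so that total is at most 0. *)
Lemma mod3_flow_flow psi : mod3_flow psi ->
  exists2 psi', mod3_flow psi' & forall v, excess psi' v = 0.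
Proof.
have [n] := ubnP (imbalance psi); elim: n psi => // n IHn psi /ltnSE-lt_n fl.
have [all0|] := boolP [forall v, excess psi v == 0].
  by exists psi => // v; apply/eqP; apply: (forallP all0).
rewrite negb_forall => /existsP[v nv0].
have sum0: \sum_v excess psi v = 0.
  by rewrite excess_sum big1 // => e _; rewrite subrr mulr0.
have [v0 pos0]: exists v0, 0 < excess psi v0.
  apply/existsP; apply: contraNT nv0; rewrite negb_exists => /forallP le0.
  have {}le0 u : excess psi u <= 0 by rewrite leNgt.
  rewrite -oppr_eq0; apply/eqP.
  have: \sum_u - excess psi u == 0 by rewrite sumrN sum0 oppr0.
  rewrite psumr_eq0 => [/allP/(_ v)|u _]; last by rewrite oppr_ge0.
  by rewrite mem_index_enum => /(_ isT)/eqP.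
pose S := connect (residual psi) v0.
have [/existsP[w /andP[Sw neg_w]]|] := boolP [exists w, S w && (excess psi w < 0)].
  have /connectP[p0 path0 lastw] := Sw.
  move: neg_w; rewrite lastw; case/shortenP: path0 => p pathp uniqp _ neg_w.
  have [psi' fl' lt'] := augment fl pathp uniqp pos0 neg_w.
  by apply: IHn fl'; apply: leq_trans lt' lt_n.
rewrite negb_exists => /forallP noneg.
have: 0 < \sum_(u | S u) excess psi u.
  rewrite (bigD1 v0) /=; last exact: connect0.
  apply: ltr_wpDr => //; apply: sumr_ge0 => u /andP[Su _].
  by have := noneg u; rewrite Su /= -leNgt.
rewrite excess_sum; suff: \sum_e psi e * ((S (tl e))%:R - (S (hd e))%:R) <= 0.
  by rewrite leNgt => /negPf->.
rewrite -oppr_ge0 -sumrN; apply: sumr_ge0 => e _; rewrite oppr_ge0.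
have [n0 _] := fl.1 e.
have Sres u w : S u -> residual psi u w -> S w.
  by move=> Su ruw; apply: connect_trans Su (connect1 ruw).
case St: (S (tl e)); case Sh: (S (hd e)); rewrite /= ?subrr ?mulr0 //.
  rewrite subr0 mulr1 leNgt; apply/negP=> gt0; move/negP: Sh; apply.
  by apply: Sres St _; apply/existsP; exists e; rewrite !eqxx gt0.
rewrite sub0r mulrN1 oppr_le0 leNgt; apply/negP=> lt0; move/negP: St; apply.
by apply: Sres Sh _; apply/existsP; exists e; rewrite !eqxx lt0 orbT.
Qed.

End ModularFlows.

Local Open Scope group_scope.

(** * Signed boundaries *)

Definition sg (b : bool) : 'F_3 := ((-1) ^+ b)%R.

Lemma sgN b : sg (~~ b) = (- sg b)%R.
Proof. by case: b; rewrite /sg ?expr0 ?expr1 ?opprK. Qed.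

Lemma mulrn3_F3 (x : 'F_3) : (x *+ 3 = 0)%R.
Proof. by case: x => [[|[|[|]]]] // i; apply/val_inj. Qed.

Section Items.

Variable gT : finGroupType.
Implicit Types (G K H R P : {group gT}) (s : seq (bool * gT)) (c : gT -> 'F_3).

(* An item (true, a) stands for one edge direction with a an involution; an item
   (false, x) stands for the two directions x and x^-1. Every edge value is +-1
   in Z/3, and c is the net outflow at the vertices in G. *)
Definition item_boundary G (it : bool * gT) c : Prop :=
  if it.1 then exists f : gT -> bool, forall g, g \in G ->
      f (g * it.2) = ~~ f g /\ c g = sg (f g)
  else exists d : gT -> bool, forall g, g \in G ->
      c g = (sg (d g) - sg (d (g * it.2^-1)%g))%R.

Fixpoint boundary G s c : Prop :=
  if s is it :: s' then
    exists2 c1, item_boundary G it c1 & boundary G s' (fun g => c g - c1 g)%R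
  else forall g, g \in G -> c g = 0%R.

Definition balanced G s := boundary G s (fun=> 0%R).

Lemma boundary_ext G s c c' :
  {in G, c =1 c'} -> boundary G s c -> boundary G s c'.
Proof.
elim: s c c' => [|it s IHs] c c' eq_c /=.
  by move=> c0 g Gg; rewrite -eq_c ?c0.
case=> c1 itc1 sc; exists c1 => //; apply: IHs sc => g Gg.
by rewrite eq_c.
Qed.

Lemma boundary_cat G s1 s2 c1 c2 :
  boundary G s1 c1 -> boundary G s2 c2 ->
  boundary G (s1 ++ s2) (fun g => c1 g + c2 g)%R.
Proof.
elim: s1 c1 => [|it s1 IHs] c1 /=.
  by move=> c10; apply: boundary_ext => g Gg; rewrite c10 ?add0r.
case=> c itc sc s2c; exists c => //.
by apply: boundary_ext (IHs _ sc s2c) => g Gg; rewrite addrAC.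
Qed.

Lemma balanced_cat G s1 s2 :
  balanced G s1 -> balanced G s2 -> balanced G (s1 ++ s2).
Proof.
move=> b1 b2; apply: boundary_ext (boundary_cat b1 b2) => g _.
by rewrite addr0.
Qed.

Lemma boundary_rem G s it c :
  it \in s -> boundary G (it :: rem it s) c -> boundary G s c.
Proof.
elim: s c => [|it' s IHs] c //=; rewrite inE.
case: eqVneq => [->|ne_it /=] //= s_it.
case=> c1 itc1 [c2 itc2 sc]; exists c2 => //; apply: IHs => //=.
by exists c1 => //; apply: boundary_ext sc => g _; rewrite addrAC.
Qed.

Lemma boundary_perm G s1 s2 c :
  perm_eq s1 s2 -> boundary G s1 c -> boundary G s2 c.
Proof.
elim: s1 s2 c => [|it s1 IHs] s2 c eq12 /=.
  by move: eq12; rewrite perm_sym => /perm_nilP->.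
have s2it: it \in s2 by rewrite -(perm_mem eq12) mem_head.
case=> c1 itc1 sc; apply: (boundary_rem s2it); exists c1 => //.
apply: IHs sc; rewrite -(perm_cons it).
by apply: perm_trans eq12 (perm_to_rem s2it).
Qed.

Definition valency s : nat := \sum_(it <- s) (if it.1 then 1 else 2).

Definition gens s : {set gT} := [set x in unzip2 s].

Lemma balanced_pair G x : balanced G [:: (false, x)].
Proof.
exists (fun=> 0%R) => /= [|g _]; last by rewrite subrr.
by exists xpredT => g _; rewrite subrr.
Qed.

Definition hom2 (K : {set gT}) (chi : gT -> bool) :=
  {in K &, {morph chi : x y / x * y >-> x (+) y}}.

(** Each left coset of [K] is identified with [K] through a representative, and [chi] is transported
    along this identification. *)
Lemma hom2_sign K chi : hom2 K chi ->
  exists f : gT -> bool, forall g k, k \in K -> f (g * k) = f g (+) chi k.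
Proof.
move=> homK; exists (fun g => chi ((repr (g *: K))^-1 * g)) => g k Kk.
have Krep: (repr (g *: K))^-1 * g \in K.
  have /lcosetP[k' Kk' ->]: repr (g *: K) \in g *: K.
    by apply: mem_repr (lcoset_refl K g).
  by rewrite invMg mulgKV groupV.
suff ->: (g * k) *: K = g *: K by rewrite mulgA homK.
by rewrite lcosetM lcoset_id.
Qed.

Lemma index2_hom2 K R : R \subset K -> #|K : R| = 2 -> hom2 K (fun x => x \notin R).
Proof.
move=> sRK iKR x y Kx Ky.
have /andP[_ nRK] := index2_normal sRK iKR.
case Rx: (x \in R); first by rewrite groupMl.
case Ry: (y \in R); first by rewrite groupMr // Rx.
have cKR: #|K / R| = 2 by rewrite card_quotient.
have Nx := subsetP nRK x Kx; have Ny := subsetP nRK y Ky.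
suff: coset R (x * y) = 1 by move/coset_idr; rewrite groupM // => ->.
have /cyclicP[u defKR]: cyclic (K / R) by rewrite prime_cyclic ?cKR.
have ou: #[u] = 2 by rewrite orderE -defKR.
have two z: z \in K -> z \notin R -> coset R z = u.
  move=> Kz Rz; have : coset R z \in K / R by rewrite mem_quotient.
  rewrite defKR => /cyclePmin[m]; rewrite ou; case: m => [|[|]] // _.
  by rewrite expg0 => /coset_idr => Rz'; rewrite Rz' ?(subsetP nRK) in Rz.
rewrite morphM //= !two ?Rx ?Ry //.
by have := expg_order u; rewrite ou.
Qed.

(** The sign [f] switches along every edge, so the graph is bipartite. Directing all edges from one
    side to the other gives each vertex net outflow 3 or -3. *)
Lemma balanced_hom2 G K chi s :
    hom2 K chi -> all (fun it => (it.2 \in K) && chi it.2) s -> valency s = 3 ->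
  balanced G s.
Proof.
case/hom2_sign=> f fM sK.
suff: boundary G s (fun g => (sg (f g)) *+ valency s)%R.
  move=> bs vs; apply: boundary_ext bs => g _.
  by rewrite vs; apply: mulrn3_F3.
rewrite /valency; elim: s sK => [|it s IHs] /=.
  by move=> _ g _; rewrite big_nil mulr0n.
case/andP=> /andP[Kit chi_it] /IHs{}IHs.
exists (fun g => sg (f g) *+ (if it.1 then 1%N else 2%N))%R; last first.
  apply: boundary_ext IHs => g _.
  by rewrite big_cons mulrnDr addrAC subrr add0r.
rewrite /item_boundary; case: it.1; exists f => g _.
  by split=> //; rewrite fM // chi_it addbT.
have := fM (g * it.2^-1) _ Kit; rewrite mulgKV chi_it addbT => ->.
by rewrite sgN mulr2n; set u := sg _; ring.
Qed.

End Items.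

(** Signs are pulled back along [tau], which need not be a morphism: it only has to respect right
    multiplication by the items. It is applied to quotient maps and to the identification of each
    coset of a subgroup with that subgroup. *)
Lemma boundary_comp (gT hT : finGroupType) (G : {group gT}) (H : {group hT})
    (tau phi : gT -> hT) (s : seq (bool * gT)) (c : hT -> 'F_3) :
    {in G, forall g, tau g \in H} ->
    (forall g it, g \in G -> it \in s -> tau (g * it.2) = tau g * phi it.2 /\
       tau (g * it.2^-1) = tau g * (phi it.2)^-1) ->
  boundary H [seq (it.1, phi it.2) | it <- s] c -> boundary G s (c \o tau).
Proof.
move=> tauH; elim: s c => [|it s IHs] c tauM /=.
  by move=> c0 g Gg; rewrite /= c0 ?tauH.
case=> c1 itc1 sc; exists (c1 \o tau).
  move: itc1; rewrite /item_boundary /=; case: it.1 => -[f fP]; exists (f \o tau).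
    move=> g Gg; have [] := fP _ (tauH _ Gg).
    by have [/= -> _] := tauM _ _ Gg (mem_head it s).
  move=> g Gg; have := fP _ (tauH _ Gg).
  by have [/= _ ->] := tauM _ _ Gg (mem_head it s).
by apply: (IHs _ _ sc) => g it' Gg s_it; apply: tauM; rewrite // inE s_it orbT.
Qed.

Lemma balanced_quotient (gT : finGroupType) (G N : {group gT}) s :
    N <| G -> {in s, forall it, it.2 \in G} ->
    balanced (G / N) [seq (it.1, coset N it.2) | it <- s] ->
  balanced G s.
Proof.
case/andP=> _ nNG sG.
apply: (@boundary_comp _ _ G (G / N)%G (coset N) (coset N) s (fun=> 0%R)).
  by move=> g Gg; apply: mem_quotient.
move=> g it Gg s_it; have nG := subsetP nNG.
by rewrite !morphM ?morphV ?groupV ?nG ?sG.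
Qed.

(** * Characters of order two and Frattini quotients *)

Section Characters.

Variable gT : finGroupType.
Implicit Types (G K H R P : {group gT}) (s : seq (bool * gT)).

(** In an item [(false, x)] the element [x] may be an involution, standing for two parallel edges;
    this occurs when [x] and its inverse are identified in a quotient. *)
Definition valid G s :=
  all (fun it => (it.2 \in G) && (if it.1 then #[it.2] == 2 else it.2 != 1)) s.

Lemma order2V (a : gT) : #[a] = 2 -> a^-1 = a.
Proof.
move=> oa; have := expg_order a; rewrite oa expgS expg1 => aa.
by apply/eqP; rewrite eq_invg_mul aa.
Qed.

(** Since [a] inverts [a * b], it normalises the rotations. If [a] were a rotation it would commute
    with [a * b], forcing order at most 2 and hence [a = 1] or [b = 1]. The case [a = b] is
    included. *)
Lemma dihedral_index2 (a b : gT) : #[a] = 2 -> #[b] = 2 ->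
  [/\ a \notin <[a * b]>, <[a * b]> \subset <<[set a; b]>>
    & #|<<[set a; b]>> : <[a * b]>| = 2].
Proof.
move=> oa ob; have Va := order2V oa; have Vb := order2V ob.
have aa: a * a = 1 by rewrite -{1}Va mulVg.
have na: a \in 'N(<[a * b]>).
  apply/normP; rewrite -cycleJ conjgE Va !mulgA aa mul1g -{2}Vb -{2}Va.
  by rewrite -invMg cycleV.
have nR: a \notin <[a * b]>.
  apply/negP=> Ra.
  have cra: commute a (a * b).
    by apply: (centsP (cycle_abelian (a * b))) => //; apply: cycle_id.
  have r2: #[a * b] %| 2.
    have ba: a * b * a = b by rewrite -cra mulgA aa mul1g.
    by rewrite order_dvdn expgS expg1 mulgA ba -{1}Vb mulVg.
  case/cyclePmin: Ra => m; rewrite ltnNge => lem def_a.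
  have: #[a * b] <= 2 by apply: dvdn_leq.
  case: m lem def_a => [|[|m]] lem def_a.
  - by move: oa; rewrite def_a expg0 order1.
  - by move: def_a; rewrite expg1 -{1}[a]mulg1 => /mulgI eq1; rewrite -eq1 order1 in ob.
  - by move=> le2; rewrite (leq_trans le2) in lem.
have sRK: <[a * b]> \subset <<[set a; b]>>.
  by rewrite cycle_subG groupM // mem_gen // !inE eqxx ?orbT.
split=> //; have tiR: <[a * b]> :&: <[a]> = 1.
  by rewrite setIC prime_TIg ?cycle_subG // -orderE oa.
have defK: <<[set a; b]>> = <[a * b]> * <[a]>.
  rewrite -norm_joinEr ?cycle_subG //; apply/eqP; rewrite eqEsubset.
  rewrite gen_subG join_subG sRK cycle_subG mem_gen ?set21 //= andbT.
  apply/subsetP=> x; rewrite !inE => /orP[]/eqP->.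
    exact: subsetP (joing_subr _ _) _ (cycle_id a).
  rewrite -{1}[b](mulKg a) groupM ?groupV //.
    exact: subsetP (joing_subr _ _) _ (cycle_id a).
  exact: subsetP (joing_subl _ _) _ (cycle_id _).
by rewrite -divgS //= {1}defK TI_cardMg // -!orderE oa mulKn.
Qed.

Lemma two_involutions_hom2 (a b : gT) : #[a] = 2 -> #[b] = 2 ->
  exists2 chi, hom2 <<[set a; b]>> chi & chi a && chi b.
Proof.
move=> oa ob; have [nRa sR iR] := dihedral_index2 oa ob.
exists (fun x => x \notin <[a * b]>); first exact: index2_hom2 sR iR.
rewrite nRa /=; apply: contra nRa => Rb.
by rewrite -{1}[a](mulgK b) groupM ?groupV ?cycle_id.
Qed.

(** The sign [f] switches along both involutions, so the two edges at a vertex can receive [f] and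
    its opposite, which cancel. *)
Lemma balanced_involutions2 G (a b : gT) : #[a] = 2 -> #[b] = 2 ->
  balanced G [:: (true, a); (true, b)].
Proof.
move=> oa ob; have [chi homK /andP[chia chib]] := two_involutions_hom2 oa ob.
have [f fM] := hom2_sign homK.
exists (fun g => sg (f g)).
  by exists f => g _; rewrite fM ?mem_gen ?set21 //= chia addbT.
exists (fun g => sg (~~ f g)).
  exists (fun g => ~~ f g) => g _; rewrite fM ?mem_gen ?set22 //=.
  by rewrite chib addbT.
by move=> g _; rewrite sgN sub0r subrr.
Qed.

Lemma balanced_even G s :
    all (fun it => it.1 ==> (#[it.2] == 2)) s -> ~~ odd (count fst s) ->
  balanced G s.
Proof.
have [n] := ubnP (size s); elim: n s => // n IHn s /ltnSE-le_s.
have [allF _ _ | ] := boolP (all (predC fst) s).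
  elim: s allF {le_s} => [|[[] x] s IHs] //= /IHs{}IHs.
  exact: (balanced_cat (balanced_pair G x) IHs).
rewrite -has_predC => /hasP[[[] a] s_a //= _] all2 ev.
have perm_s := perm_to_rem s_a.
have ev': odd (count fst (rem (true, a) s)).
  by move: ev; rewrite (seq.permP perm_s) /= => /negbNE.
have: has fst (rem (true, a) s) by rewrite has_count; case: count ev'.
case/hasP=> [[[] b] s_b //= _].
have perm_s' := perm_to_rem s_b.
set s2 := rem _ (rem _ _) in perm_s'.
have perm2: perm_eq s ([:: (true, a); (true, b)] ++ s2).
  by apply: (perm_trans perm_s); rewrite /= perm_cons.
move: all2; rewrite (perm_all _ perm2) /= => /and3P[/eqP oa /eqP ob all2].
rewrite perm_sym in perm2; apply: (boundary_perm perm2).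
apply: balanced_cat (balanced_involutions2 G oa ob) (IHn _ _ all2 _).
  by have := perm_size perm2; rewrite /= => eqs; lia.
by move: ev'; rewrite (seq.permP perm_s') /= => /negPf->.
Qed.

Lemma balanced_sub G s s0 s1 :
    perm_eq s (s0 ++ s1) -> valid G s -> odd (count fst s) ->
    odd (count fst s0) -> balanced G s0 ->
  balanced G s.
Proof.
move=> perm_s vs odds odds0 bs0; apply: (@boundary_perm _ _ (s0 ++ s1)).
  by rewrite perm_sym.
apply: balanced_cat bs0 (balanced_even _ _ _).
  apply/allP=> it s1it; have := allP vs it; rewrite (perm_mem perm_s) mem_cat.
  by rewrite s1it orbT => /(_ isT)/andP[_]; case: it.1.
by move: odds; rewrite (seq.permP perm_s) count_cat oddD odds0.
Qed.

Lemma hom2_xor K chi1 chi2 :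
  hom2 K chi1 -> hom2 K chi2 -> hom2 K (fun x => chi1 x (+) chi2 x).
Proof. by move=> h1 h2 x y Kx Ky; rewrite h1 ?h2 // addbACA. Qed.

Lemma hom2_notPhi P (u : gT) : 2.-group P -> u \in P -> u \notin 'Phi(P) ->
  exists2 chi, hom2 P chi & chi u.
Proof.
move=> pP Pu nPhi.
have [R maxR nRu]: exists2 R : {group gT}, maximal R P & u \notin R.
  apply/exists_inP; apply: contraNT nPhi; rewrite negb_exists_in => /forall_inP noR.
  apply/bigcapP=> R; case/predU1P=> [-> //|maxR].
  by have := noR R maxR; rewrite negbK.
exists (fun x => x \notin R) => //; apply: index2_hom2 (p_maximal_index pP maxR).
exact: proper_sub (maxgroupp maxR).
Qed.

Lemma hom2_notPhi2 P (u v : gT) : 2.-group P -> u \in P -> v \in P ->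
    u \notin 'Phi(P) -> v \notin 'Phi(P) ->
  exists2 chi, hom2 P chi & chi u && chi v.
Proof.
move=> pP Pu Pv nu nv.
have [chi1 h1 c1] := hom2_notPhi pP Pu nu.
have [chi2 h2 c2] := hom2_notPhi pP Pv nv.
case c1v: (chi1 v); first by exists chi1; rewrite ?c1.
case c2u: (chi2 u); first by exists chi2; rewrite ?c2 ?c2u.
by exists (fun x => chi1 x (+) chi2 x); [apply: hom2_xor | rewrite c1 c2 c1v c2u].
Qed.

(** A character that is nontrivial on [a * b * c] is nontrivial on all three elements or on exactly
    one. In the latter case take a character nontrivial on the other two: either it or its sum with
    the first one works. *)
Lemma hom2_notPhi3 P (a b c : gT) : 2.-group P ->
    a \in P -> b \in P -> c \in P ->
    a \notin 'Phi(P) -> b \notin 'Phi(P) -> c \notin 'Phi(P) ->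
    a * b * c \notin 'Phi(P) ->
  exists2 chi, hom2 P chi & [&& chi a, chi b & chi c].
Proof.
move=> pP Pa Pb Pc na nb nc nabc.
have [chi h chi_abc] := hom2_notPhi pP (groupM (groupM Pa Pb) Pc) nabc.
move: chi_abc; rewrite !h ?groupM //.
have [chi1 h1 /andP[c1b c1c]] := hom2_notPhi2 pP Pb Pc nb nc.
have [chi2 h2 /andP[c2a c2c]] := hom2_notPhi2 pP Pa Pc na nc.
have [chi3 h3 /andP[c3a c3b]] := hom2_notPhi2 pP Pa Pb na nb.
have fin chi' : hom2 P chi' -> [&& chi' a, chi' b & chi' c] ->
  exists2 chi, hom2 P chi & [&& chi a, chi b & chi c] by exists chi'.
case ca: (chi a); case cb: (chi b); case cc: (chi c) => // _.
- by apply: (fin chi); rewrite ?ca ?cb.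
- case c1a: (chi1 a); first by apply: (fin chi1); rewrite ?c1a ?c1b.
  by apply: fin (hom2_xor h h1) _; rewrite ca cb cc c1a c1b c1c.
- case c2b: (chi2 b); first by apply: (fin chi2); rewrite ?c2a ?c2b.
  by apply: fin (hom2_xor h h2) _; rewrite ca cb cc c2a c2b c2c.
- case c3c: (chi3 c); first by apply: (fin chi3); rewrite ?c3a ?c3b.
  by apply: fin (hom2_xor h h3) _; rewrite ca cb cc c3a c3b c3c.
Qed.

Lemma Phi_sub_gen P (A : {set gT}) :
  P \subset <<A :|: 'Phi(P)>> -> A \subset P -> <<A>> = P.
Proof.
move=> sP sA; apply: Phi_nongen; apply/eqP; rewrite eqEsubset join_subG Phi_sub sA /=.
by apply: subset_trans sP _; rewrite setUC.
Qed.

(** Neither generator of [K] lies in its Frattini subgroup: a generator in ['Phi(K)] could be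
    dropped, making [K] cyclic on the other one. *)
Lemma hom2_incomparable P (a y : gT) : 2.-group P -> a \in P -> y \in P ->
    a \notin <[y]> -> y \notin <[a]> ->
  exists2 chi, hom2 <<[set a; y]>> chi & chi a && chi y.
Proof.
move=> pP Pa Py nya nay; pose K := <<[set a; y]>>%G.
have sKP: K \subset P by rewrite gen_subG subUset !sub1set Pa.
have Ka: a \in K by rewrite mem_gen ?set21.
have Ky: y \in K by rewrite mem_gen ?set22.
have pK: 2.-group K := pgroupS sKP pP.
apply: (@hom2_notPhi2 K) => //.
  apply: contra nya => Phia; rewrite /cycle (@Phi_sub_gen K [set y]) ?sub1set //.
  by rewrite gen_subG subUset !sub1set !mem_gen // !inE ?Phia ?eqxx ?orbT.
apply: contra nay => Phiy; rewrite /cycle (@Phi_sub_gen K [set a]) ?sub1set //.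
by rewrite gen_subG subUset !sub1set !mem_gen // !inE ?Phiy ?eqxx ?orbT.
Qed.

Lemma Phi_dihedral P (a b : gT) : #[a] = 2 -> #[b] = 2 ->
  <<[set a; b]>> = P -> 'Phi(P) \subset <[a * b]>.
Proof.
move=> oa ob defP; have [_ sR iR] := dihedral_index2 oa ob.
rewrite defP in sR iR.
by apply: Phi_sub_max; apply: p_index_maximal => //; rewrite iR.
Qed.

Lemma cycle_involution_eq (r u v : gT) :
  u \in <[r]> -> v \in <[r]> -> #[u] = 2 -> #[v] = 2 -> u = v.
Proof.
move=> ru rv ou ov.
have eqC: <[u]> = <[v]>.
  apply/eqP; rewrite (eq_subG_cyclic (cycle_cyclic r)) ?cycle_subG //.
  by rewrite -!orderE ou ov.
apply/eqP; have: u \in <[v]> by rewrite -eqC cycle_id.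
by case/cyclePmin=> -[|[|m]]; rewrite ov // => _ def_u; move: ou; rewrite def_u ?order1 ?expg1.
Qed.

End Characters.

(** * A central involution and two incomparable cycles *)

Section Cobound.

Variables (hT : finGroupType) (H : {group hT}).

(** A linear system mod 2: [u] and [v] are the unknown corrections to the signs along the cycles of
    [x] and of [y], and [c] prescribes the total number of direction switches mod 2 at each
    vertex. *)
Definition cobound (x y : hT) (c : hT -> bool) :=
  exists u v : hT -> bool, {in H, forall g,
    c g = (u g (+) u (g * x^-1)) (+) (v g (+) v (g * y^-1))}.

Lemma coboundD x y c1 c2 :
  cobound x y c1 -> cobound x y c2 -> cobound x y (fun g => c1 g (+) c2 g).
Proof.
case=> u1 [v1 E1] [u2 [v2 E2]].
exists (fun g => u1 g (+) u2 g), (fun g => v1 g (+) v2 g) => g Hg.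
by rewrite E1 ?E2 // addbACA; congr (_ (+) _); rewrite addbACA.
Qed.

Lemma cobound_ext x y c1 c2 : {in H, c1 =1 c2} -> cobound x y c1 -> cobound x y c2.
Proof. by move=> E [u [v E1]]; exists u, v => g Hg; rewrite -E ?E1. Qed.

(** Follow a word in [x] and [y] from [h] to [k]; each letter contributes the difference of two
    consecutive point masses, and the sum telescopes. *)
Lemma cobound_delta x y h k : <<[set x; y]>> = H -> h \in H -> k \in H ->
  cobound x y (fun g => (g == h) (+) (g == k)).
Proof.
move=> defH Hh Hk; have: h^-1 * k \in <<[set x; y]>> by rewrite defH groupM ?groupV.
case/gen_prodgP=> n [c cA] def_k; rewrite -[k](mulKVg h) {}def_k.
elim: n c cA => [|n IHn] c cA.
  exists xpred0, xpred0 => g _ /=; rewrite big_ord0 mulg1 addbb //.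
rewrite big_ord_recr /= mulgA; set h' := h * _.
have Hc i : c i \in H.
  by rewrite -defH mem_gen ?cA.
have: cobound x y (fun g => (g == h') (+) (g == h' * c ord_max)).
  have := cA ord_max; rewrite !inE => /orP[]/eqP->.
    exists (fun g => g == h'), xpred0 => g _ /=.
    by rewrite addbF (can2_eq (mulgKV x) (mulgK x)).
  exists xpred0, (fun g => g == h') => g _ /=.
  by rewrite (can2_eq (mulgKV y) (mulgK y)).
have := IHn (fun i => c (widen_ord (leqnSn n) i)) (fun i => cA _).
move=> c1 c2; apply: cobound_ext (coboundD c1 c2) => g _.
by rewrite /= -/h' addbA addbK.
Qed.

(* On a connected graph the only obstruction to being a coboundary mod 2 is the
   total sum. *)
Lemma sum0_cobound x y (c : hT -> bool) : <<[set x; y]>> = H ->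
  \big[addb/false]_(g in H) c g = false -> cobound x y c.
Proof.
move=> defH sum0.
(* The values of [c] at the members of [r] are moved one by one to the point 1; over all of [H] they
   cancel there because the total is 0. *)
have part r : {subset r <= H} -> cobound x y (fun k =>
    \big[addb/false]_(g <- r) (c g && (k == g)) (+)
    (\big[addb/false]_(g <- r) c g && (k == 1))).
  elim: r => [|h r IHr] sr.
    by exists xpred0, xpred0 => g _ /=; rewrite !big_nil.
  have {IHr}c1 := IHr (fun g rg => sr g (mem_behead (s := h :: r) rg)).
  have c2: cobound x y (fun k => (c h && (k == h)) (+) (c h && (k == 1))).
    case: (c h) => /=; last by exists xpred0, xpred0.
    by apply: cobound_delta; rewrite ?group1 // sr ?mem_head.
  apply: cobound_ext (coboundD c1 c2) => k _; rewrite !big_cons /=.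
  set S := \big[_/_]_(g <- r) _; set T := \big[_/_]_(g <- r) _.
  by case: S T (c h) (k == h) (k == 1) => [] [] [] [] [].
have /part: {subset enum H <= H} by move=> g; rewrite mem_enum.
apply: cobound_ext => k Hk; rewrite !big_enum sum0 /= addbF.
rewrite (bigD1 k) //= eqxx andbT big1 ?addbF // => g /andP[_].
by rewrite eq_sym => /negPf->; rewrite andbF.
Qed.

(** Left multiplication by [k] exchanges [R] with its complement, so the sums over the two halves
    agree and cancel mod 2. *)
Lemma big_addb_index2 (R : {group hT}) k (F : hT -> bool) :
    R \subset H -> #|H : R| = 2 -> k \in H -> k \notin R ->
    {in R, forall q, F (k * q) = F q} ->
  \big[addb/false]_(q in H) F q = false.
Proof.
move=> sRH iHR Hk nRk Fk; have homR := index2_hom2 sRH iHR.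
rewrite (bigID (mem R)) /= [X in _ (+) X](reindex_inj (mulgI k)) /=.
rewrite [X in _ (+) X](eq_bigl (fun q => (q \in H) && (q \in R))); last first.
  move=> q; rewrite groupMl //; case Hq: (q \in H) => //=.
  by rewrite homR // nRk; case: (q \in R).
rewrite [X in _ (+) X](eq_bigr F) ?addbb // => q /andP[_ Rq].
exact: Fk.
Qed.

End Cobound.

(** The edges stay inside left cosets of [K], and each coset carries a copy of the flow on [K]. *)
Lemma balanced_subgroup (gT : finGroupType) (G K : {group gT}) s :
  {in s, forall it, it.2 \in K} -> balanced K s -> balanced G s.
Proof.
move=> sK bs; pose tau (g : gT) := (repr (g *: K))^-1 * g.
have tauM g k : k \in K -> tau (g * k) = tau g * k.
  by move=> Kk; rewrite /tau lcosetM lcoset_id // mulgA.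
apply: (@boundary_comp _ _ G K tau id s (fun=> 0%R)); last by rewrite map_id_in // => -[].
  move=> g _; rewrite /tau; have /lcosetP[k' Kk' ->]: repr (g *: K) \in g *: K.
    by apply: mem_repr (lcoset_refl K g).
  by rewrite invMg mulgKV groupV.
by move=> g it _ s_it; rewrite !tauM ?groupV ?sK.
Qed.

Section CentralInvolution.

Variables (gT : finGroupType) (K : {group gT}).
Hypothesis pK : 2.-group K.

(** This makes the parity obstruction of [sum0_cobound] vanish. As [z] lies in [<[x]>], the image of
    [y] in [K / <[z]>] is not a power of that of [x], so some subgroup [R] of index 2 contains the
    image of [x] but not that of [y]; the two halves are made to contribute equally. *)
Let half_sign (x y z : gT) : <<[set x; y]>> = K -> #[z] = 2 -> z \in 'C(K) ->
    z \in <[x]> -> y \notin <[x]> ->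
  exists e : gT -> bool, [/\ {in K, forall g, e (g * z) = ~~ e g},
    \big[addb/false]_(q in K / <[z]>) (e (repr q) (+) e (repr q * x^-1)) = false
  & \big[addb/false]_(q in K / <[z]>) true = false].
Proof.
move=> defK oz cKz xz nxy.
have Kx: x \in K by rewrite -defK mem_gen ?set21.
have Ky: y \in K by rewrite -defK mem_gen ?set22.
have Kz: z \in K by rewrite (subsetP _ _ xz) // cycle_subG.
have nZ: K \subset 'N(<[z]>) by rewrite cents_norm // centsC cycle_subG.
have nZx := subsetP nZ.
have sXH: <[coset <[z]> x]> \subset K / <[z]> by rewrite cycle_subG mem_quotient.
have nXy: coset <[z]> y \notin <[coset <[z]> x]>.
  apply: contra nxy => /cycleP[m]; rewrite -morphX ?nZx // => eq_yx.
  have [t Zt ->] := kercoset_rcoset (nZx _ Ky) (nZx _ (groupX m Kx)) eq_yx.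
  by rewrite groupM ?mem_cycle // (subsetP _ _ Zt) // cycle_subG.
have [eqX|[R maxR sXR]] := maximal_exists sXH.
  by rewrite eqX mem_quotient in nXy.
have iR: #|K / <[z]> : R| = 2 := p_maximal_index (quotient_pgroup _ pK) maxR.
have /andP[sRH nsHR] := maxgroupp maxR.
have Rx: coset <[z]> x \in R by rewrite -cycle_subG.
have nRy: coset <[z]> y \notin R.
  apply: contra nsHR => Ry; rewrite /= /quotient -defK morphim_gen; last first.
    by rewrite subUset !sub1set !nZx.
  rewrite gen_subG; apply/subsetP=> _ /morphimP[g _ + ->].
  by rewrite !inE => /orP[]/eqP->.
have Hy: coset <[z]> y \in K / <[z]> by rewrite mem_quotient.
have [e1 e1z]: exists e1 : gT -> bool, forall g, e1 (g * z) = ~~ e1 g.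
  have [chi homz /andP[chiz _]] := two_involutions_hom2 oz oz.
  have [e1 e1M] := hom2_sign homz; exists e1 => g.
  by rewrite e1M ?mem_gen ?set21 // chiz addbT.
(* Outside [R], [e] is the left translate by [y] of its values over [R]; left translation commutes
   with the [x]-edges. *)
pose e g := if coset <[z]> g \in R then e1 g else e1 (y^-1 * g).
have cz g : g \in K -> g * z = z * g by move=> Kg; rewrite (centP cKz).
have ez: {in K, forall g, e (g * z) = ~~ e g}.
  move=> g Kg; rewrite /e coset_kerr ?cycle_id //.
  by case: ifP => _; rewrite ?mulgA e1z.
exists e; split=> //; last exact: (big_addb_index2 sRH iR Hy nRy).
pose E g := e g (+) e (g * x^-1).
have Ez g : g \in K -> E (g * z) = E g.
  move=> Kg; rewrite /E ez // -mulgA -cz ?groupV // mulgA ez ?groupM ?groupV //.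
  by rewrite addNb addbN negbK.
have FE g : g \in K -> E (repr (coset <[z]> g)) = E g.
  move=> Kg; have := mem_repr_coset (coset <[z]> g); rewrite val_coset ?nZx //.
  case/rcosetP=> t /cyclePmin[m]; rewrite oz => lt_m -> ->.
  case: m lt_m => [|[|//]] _; first by rewrite expg0 mul1g.
  by rewrite expg1 -cz ?Ez.
suff FR: {in R, forall q, E (repr (coset <[z]> y * q)) = E (repr q)}.
  exact: (big_addb_index2 sRH iR Hy nRy FR).
move=> q Rq.
have /morphimP[g _ Kg def_q] := subsetP sRH q Rq.
rewrite def_q in Rq *; rewrite -[_ * _]morphM ?nZx //= !FE ?groupM //.
have Rgx: coset <[z]> (g * x^-1) \in R.
  by rewrite morphM ?morphV ?groupV ?nZx //= groupM ?groupV.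
have nRyM h : h \in K -> coset <[z]> h \in R -> coset <[z]> (y * h) \in R = false.
  by move=> Kh Rh; rewrite morphM ?nZx //= groupMr ?(negPf nRy).
rewrite /E /e -mulgA !nRyM ?groupM ?groupV // Rgx !mulKg.
by rewrite [coset _ g \in R]Rq.
Qed.

(* With e, d the signs on the x- and y-edges, exactly one of the two cycles
   through each vertex g switches direction there, and its net outflow +-2
   is compensated by the edge z. *)
Lemma balanced_central_involution (x y z : gT) (G : {group gT}) :
    <<[set x; y]>> = K -> #[z] = 2 -> z \in <[x]> -> z \in <[y]> ->
    x \notin <[y]> -> y \notin <[x]> ->
  balanced G [:: (true, z); (false, x); (false, y)].
Proof.
move=> defK oz xz yz nyx nxy.
have Kx: x \in K by rewrite -defK mem_gen ?set21.
have Ky: y \in K by rewrite -defK mem_gen ?set22.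
have Kz: z \in K by rewrite (subsetP _ _ xz) // cycle_subG.
have cKz: z \in 'C(K).
  rewrite -defK cent_gen; apply/centP=> g; rewrite !inE => /orP[]/eqP->.
    by apply: (centsP (cycle_abelian x)); rewrite ?cycle_id.
  by apply: (centsP (cycle_abelian y)); rewrite ?cycle_id.
have cz g : g \in K -> g * z = z * g by move=> Kg; rewrite (centP cKz).
have [e0 [e0z sume sum1]] := half_sign defK oz cKz xz nxy.
have defK': <<[set y; x]>> = K by rewrite setUC.
have [d0 [d0z sumd _]] := half_sign defK' oz cKz yz nyx.
have nZ: K \subset 'N(<[z]>) by rewrite cents_norm // centsC cycle_subG.
have nZx := subsetP nZ.
pose E g := e0 g (+) e0 (g * x^-1); pose D g := d0 g (+) d0 (g * y^-1).
(* The defect of the provisional signs: [c g] is false exactly when one of the two cycles, and not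
   both, switches direction at [g]. *)
pose c g := E g (+) D g (+) true.
have cZ g : g \in K -> c (g * z) = c g.
  move=> Kg; rewrite /c /E /D e0z ?d0z // -!mulgA -!cz ?groupV // !mulgA.
  rewrite e0z ?d0z ?groupM ?groupV //.
  by rewrite !(addNb, addbN, negbK).
have cH g : g \in K -> c (repr (coset <[z]> g)) = c g.
  move=> Kg; have := mem_repr_coset (coset <[z]> g); rewrite val_coset ?nZx //.
  case/rcosetP=> t /cyclePmin[m]; rewrite oz => lt_m -> ->.
  case: m lt_m => [|[|//]] _; first by rewrite expg0 mul1g.
  by rewrite expg1 -cz ?cZ.
have defH: <<[set coset <[z]> x; coset <[z]> y]>> = K / <[z]>.
  rewrite /quotient -defK morphim_gen ?morphimU ?morphim_set1 ?nZx //.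
  by rewrite subUset !sub1set !nZx.
have [|u [v uv]] := @sum0_cobound _ (K / <[z]>)%G _ _ (fun q => c (repr q)) defH.
  have sumE: \big[addb/false]_(q in K / <[z]>) E (repr q) = false := sume.
  have sumD: \big[addb/false]_(q in K / <[z]>) D (repr q) = false := sumd.
  by rewrite [LHS]big_split /= [X in X (+) _]big_split /= sumE sumD sum1.
(* The corrections live on [K / <[z]>], so the switching along [z] is preserved. *)
pose e g := e0 g (+) u (coset <[z]> g); pose d g := d0 g (+) v (coset <[z]> g).
have ez g : g \in K -> e (g * z) = ~~ e g.
  by move=> Kg; rewrite /e e0z // coset_kerr ?cycle_id // addNb.
have dz g : g \in K -> d (g * z) = ~~ d g.
  by move=> Kg; rewrite /d d0z // coset_kerr ?cycle_id // addNb.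
have turn g : g \in K -> (e g (+) e (g * x^-1)) (+) (d g (+) d (g * y^-1)) = true.
  move=> Kg; have := uv _ (mem_quotient <[z]> Kg); rewrite cH // /c /E /D.
  rewrite /e /d !morphM ?morphV ?groupV ?nZx //=.
  move: (e0 g) (e0 (g * _)) (d0 g) (d0 (g * _)) (u _) (u (_ * _)) (v _) (v (_ * _)).
  by do 8!case.
apply: (@balanced_subgroup _ G K).
  by move=> it; rewrite !inE => /or3P[]/eqP->.
(* The cycle that switches at [g] has net outflow twice its sign there, so giving the same sign to
   the [z]-edge makes the total a multiple of 3. *)
exists (fun g => sg (if e g (+) e (g * x^-1) then e g else d g)).
  exists (fun g => if e g (+) e (g * x^-1) then e g else d g) => g Kg; split=> //=.
  rewrite -mulgA -cz ?groupV // mulgA !ez ?dz ?groupM ?groupV //.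
  by rewrite addNb addbN negbK; case: ifP.
exists (fun g => sg (e g) - sg (e (g * x^-1)%g))%R; first by exists e.
exists (fun g => sg (d g) - sg (d (g * y^-1)%g))%R; first by exists d.
move=> g Kg; have := turn g Kg.
move: (e g) (e (g * x^-1)) (d g) (d (g * y^-1)).
by move=> [] [] [] [] //= _; apply/val_inj.
Qed.

End CentralInvolution.

(** * Two-groups *)

Lemma perm_to_rem2 (T : eqType) (s : seq T) x y :
  x \in s -> y \in s -> x != y -> perm_eq s [:: x, y & rem y (rem x s)].
Proof.
move=> sx sy ne_xy; have perm_s := perm_to_rem sx.
apply: (perm_trans perm_s); rewrite perm_cons; apply: perm_to_rem.
by move: sy; rewrite (perm_mem perm_s) inE eq_sym (negPf ne_xy).
Qed.

Section TwoGroups.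

Variable gT : finGroupType.
Implicit Types (G P : {group gT}) (s : seq (bool * gT)) (A : seq gT).

Lemma balanced_involution_pair G P (a y : gT) : 2.-group P -> a \in P -> y \in P ->
    #[a] = 2 -> y != 1 -> (y == a) || (a \notin <[y]>) ->
  balanced G [:: (true, a); (false, y)].
Proof.
move=> pP Pa Py oa nty; case/predU1P=> [->|nya].
  have [chi homK /andP[chia _]] := two_involutions_hom2 oa oa.
  apply: (balanced_hom2 _ homK) => [/=|]; last by rewrite /valency !big_cons big_nil.
  by rewrite mem_gen ?set21 ?chia.
have [|chi homK /andP[chia chiy]] := hom2_incomparable pP Pa Py nya.
  apply/negP=> /cyclePmin[[|[|m]]]; rewrite oa // => _ def_y.
    by rewrite def_y eqxx in nty.
  by rewrite def_y expg1 cycle_id in nya.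
apply: (balanced_hom2 _ homK) => [/=|]; last by rewrite /valency !big_cons big_nil.
by rewrite !mem_gen ?set21 ?set22 ?chia ?chiy.
Qed.

Lemma balanced_involution_dup G (z a : gT) : #[z] = 2 -> #[a] = 2 ->
  balanced G [:: (true, z); (true, z); (true, a)].
Proof.
move=> oz oa; have [chi homK /andP[chiz chia]] := two_involutions_hom2 oz oa.
apply: (balanced_hom2 _ homK) => [/=|]; last by rewrite /valency !big_cons big_nil.
by rewrite !mem_gen ?set21 ?set22 ?chiz ?chia.
Qed.

(** A repeated involution is easy. Otherwise one looks for three members outside ['Phi(P)] whose
    product is outside ['Phi(P)] too. Among four members [a, b, c, d] of [A'] one of [abc], [abd],
    [acd] works; with fewer, [P] is cyclic, a good triple exists, or [P] is dihedral and too many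
    involutions lie in ['Phi(P)]. *)
Lemma balanced_involutions P A : 2.-group P -> ~~ cyclic P ->
    all (fun x => (x \in P) && (#[x] == 2)) A -> <<[set x in A]>> = P ->
    odd (size A) -> 4 < size A ->
  balanced P [seq (true, a) | a <- A].
Proof.
move=> pP ncP allA defP oddA sizeA.
have AP x : x \in A -> x \in P by case/(allP allA)/andP.
have A2 x : x \in A -> #[x] = 2 by case/(allP allA)/andP=> _ /eqP.
have vA: valid P [seq (true, a) | a <- A] by rewrite /valid all_map.
have oddF: odd (count fst [seq (true, a) | a <- A]).
  by rewrite count_map (eq_count (a2 := predT)) ?count_predT.
have sub3 a b c A1 : perm_eq A [:: a, b, c & A1] ->
    balanced P [:: (true, a); (true, b); (true, c)] ->
    balanced P [seq (true, a) | a <- A].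
  move=> permA; apply: (balanced_sub (s1 := map (pair true) A1)) => //.
  exact: (perm_map _ permA).
have [uA|] := boolP (uniq A); last first.
  case/(uniqPn 1)=> i [j [lt_ij ltj eq_ij]].
  have Az: nth 1 A i \in A by rewrite mem_nth // (ltn_trans lt_ij).
  set z := nth 1 A i in eq_ij Az.
  have count2: 1 < count_mem z A.
    rewrite -(cat_take_drop j A) count_cat -(add1n 1) leq_add // -has_count has_pred1.
      by rewrite /z -(nth_take 1 lt_ij) mem_nth // size_take ltj.
    by rewrite eq_ij -[j in nth _ _ j]addn0 -nth_drop mem_nth // size_drop subn_gt0.
  have perm1 := perm_to_rem Az.
  have Az2: z \in rem z A.
    by rewrite -has_pred1 has_count; move: count2; rewrite (seq.permP perm1) /= eqxx.
  have perm2 := perm_to_rem Az2.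
  have permA: perm_eq A [:: z, z & rem z (rem z A)].
    by apply: (perm_trans perm1); rewrite perm_cons.
  move: (rem z (rem z A)) permA {perm2} => [|a A1] permA.
    by move: sizeA; rewrite (perm_size permA).
  apply: (sub3 _ _ _ _ permA); apply: balanced_involution_dup; rewrite ?A2 //.
  by rewrite (perm_mem permA) !inE eqxx !orbT.
have permA: perm_eq A ([seq x <- A | x \notin 'Phi(P)] ++ [seq x <- A | x \in 'Phi(P)]).
  by rewrite perm_sym perm_catC perm_filterC.
move: permA; set A' := [seq x <- A | x \notin _]; set A'' := [seq x <- A | _] => permA.
have A'P x : x \in A' -> [/\ x \in P, #[x] = 2 & x \notin 'Phi(P)].
  by rewrite mem_filter => /andP[? Ax]; rewrite A2 ?AP.
have defP' : <<[set x in A']>> = P.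
  apply: Phi_sub_gen; last by apply/subsetP=> x; rewrite inE => /A'P[].
  rewrite -{1}defP genS //; apply/subsetP=> x; rewrite !inE mem_filter => ->.
  by rewrite andbT orNb.
(* In this case ['Phi(P)] lies in the cyclic group [<[a * b]>], which has at most one involution. *)
have PhiA'' a b : <<[set a; b]>> = P -> #[a] = 2 -> #[b] = 2 -> 1 < size A'' -> False.
  move=> defab oa ob.
  have uA'': uniq A'' by apply: filter_uniq.
  case defA'': A'' uA'' => [|u [|v A3]] // uA'' _.
  have inA'' w : w \in A'' -> #[w] = 2 /\ w \in <[a * b]>.
    rewrite mem_filter => /andP[Phiw Aw]; split; first exact: A2.
    exact: subsetP (Phi_dihedral oa ob defab) _ Phiw.
  have [ou cu] : #[u] = 2 /\ u \in <[a * b]> by apply: inA''; rewrite defA'' !inE eqxx.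
  have [ov cv] : #[v] = 2 /\ v \in <[a * b]> by apply: inA''; rewrite defA'' !inE eqxx orbT.
  by move: uA''; rewrite /= inE (cycle_involution_eq cu cv ou ov) eqxx.
have good3 a b c A1 : perm_eq A [:: a, b, c & A1] ->
    a \in A' -> b \in A' -> c \in A' -> a * b * c \notin 'Phi(P) ->
    balanced P [seq (true, a) | a <- A].
  move=> perm3 /A'P[Pa _ na] /A'P[Pb _ nb] /A'P[Pc _ nc] nabc.
  have [chi homP /and3P[ca cb cc]] := hom2_notPhi3 pP Pa Pb Pc na nb nc nabc.
  apply: (sub3 _ _ _ _ perm3); apply: (balanced_hom2 _ homP) => [/=|]; last first.
    by rewrite /valency !big_cons big_nil.
  by rewrite Pa Pb Pc ca cb cc.
have sizeAA: size A = size A' + size A'' by rewrite (perm_size permA) size_cat.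
case defA': A' defP' => [|a [|b [|c [|d A1]]]] defP'.
- have s0: [set x : gT in [::]] = set0 by apply/setP=> x; rewrite !inE.
  by case/negP: ncP; rewrite -defP' s0 gen0 cyclic1.
- have s1: [set x : gT in [:: a]] = [set a] by apply/setP=> x; rewrite !inE.
  by case/negP: ncP; rewrite -defP' s1 cycle_cyclic.
- have [] := @PhiA'' a b; last by move: sizeA; rewrite sizeAA defA' => /ltnW.
  + by rewrite -defP'; congr <<_>>; apply/setP=> x; rewrite !inE.
  + by case: (A'P a); rewrite // defA' !inE eqxx.
  + by case: (A'P b); rewrite // defA' !inE eqxx orbT.
- have A'a: a \in A' by rewrite defA' !inE eqxx.
  have A'b: b \in A' by rewrite defA' !inE eqxx orbT.
  have A'c: c \in A' by rewrite defA' !inE eqxx !orbT.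
  have [abc|] := boolP (a * b * c \in 'Phi(P)); last first.
    by apply: good3 => //; move: permA; rewrite defA'; apply.
  have [] := @PhiA'' a b; last by move: sizeA; rewrite sizeAA defA'.
  + apply: Phi_sub_gen; last first.
      by rewrite subUset !sub1set; case: (A'P a A'a) => -> _ _; case: (A'P b A'b).
    rewrite -{1}defP' gen_subG; apply/subsetP=> x; rewrite !inE.
    case/or3P=> /eqP->; try by rewrite mem_gen // !inE eqxx ?orbT.
    rewrite -[c](mulKg (a * b)) groupM ?groupV //.
      by rewrite groupM ?mem_gen // !inE eqxx ?orbT.
    by rewrite mem_gen // inE abc orbT.
  + by case: (A'P a).
  + by case: (A'P b).
have A'a: a \in A' by rewrite defA' !inE eqxx.
have A'b: b \in A' by rewrite defA' !inE eqxx orbT.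
have A'c: c \in A' by rewrite defA' !inE eqxx !orbT.
have A'd: d \in A' by rewrite defA' !inE eqxx !orbT.
move: permA; rewrite defA' /=; move: (A1 ++ A'') => A2' permA.
have [abc|nabc] := boolP (a * b * c \in 'Phi(P)); last exact: good3 permA _ _ _ nabc.
have [abd|nabd] := boolP (a * b * d \in 'Phi(P)); last first.
  apply: (good3 a b d (c :: A2')) nabd => //.
  by apply: (perm_trans permA); rewrite !perm_cons (perm_catCA [:: c] [:: d]).
apply: (good3 a c d (b :: A2')) => //.
  apply: (perm_trans permA); rewrite perm_cons.
  by rewrite (perm_catCA [:: b] [:: c; d]).
have [_ oc _] := A'P _ A'c; have [_ _ na] := A'P _ A'a.
apply: contra na => acd.
have cd: c * d \in 'Phi(P).
  have := groupM (groupVr abc) abd.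
  by rewrite invMg (order2V oc) -mulgA mulKg.
by move: acd; rewrite -mulgA groupMr.
Qed.

Lemma balanced_2group P s : 2.-group P -> ~~ cyclic P -> valid P s ->
    <<gens s>> = P -> odd (count fst s) -> 4 < valency s ->
  balanced P s.
Proof.
move=> pP ncP vs defP odds vals.
have itP it : it \in s -> it.2 \in P by case/(allP vs)/andP.
have invP a : (true, a) \in s -> #[a] = 2 by case/(allP vs)/andP=> _ /eqP.
have pairP y : (false, y) \in s -> y != 1 by case/(allP vs)/andP.
have: has fst s by rewrite has_count; case: count odds.
case/hasP=> [[[] z] s_z //= _].
have [noY|] := boolP (all fst s).
  have defs: s = [seq (true, a) | a <- unzip2 s].
    elim: s noY {vs defP odds vals itP invP pairP s_z} => [|[[] x] s IHs] //= {}/IHs IHs.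
    by rewrite -IHs.
  rewrite defs; apply: balanced_involutions => //.
  - apply/allP=> _ /mapP[[b x] s_x ->]; have /= := allP noY _ s_x.
    by case: b s_x => // s_x _; rewrite (itP _ s_x) invP.
  - by move: odds; rewrite size_map; move: noY; rewrite all_count => /eqP->.
  - rewrite size_map; suff <-: valency s = size s by [].
    by rewrite /valency -sum1_size; apply: eq_big_seq => it /(allP noY)->.
rewrite -has_predC => /hasP[[[] y0] s_y0 //= _].
have [/hasP[[[] a] s_a //= /hasP[[[] y] s_y //= good]]|] :=
  boolP (has (fun it => it.1 && has (fun it' => ~~ it'.1 &&
    ((it'.2 == it.2) || (it.2 \notin <[it'.2]>))) s) s).
  have perm_s := perm_to_rem2 s_a s_y isT.
  apply: (@balanced_sub _ P s [:: (true, a); (false, y)] _ perm_s) => //.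
  by apply: balanced_involution_pair pP (itP _ s_a) (itP _ s_y) (invP _ s_a) (pairP _ s_y) good.
move=> /hasPn bad.
have az a y : (true, a) \in s -> (false, y) \in s -> a \in <[y]>.
  move=> s_a s_y; have /= /hasPn/(_ _ s_y) := bad _ s_a.
  by rewrite /= negb_or negbK => /andP[].
(* All involutions of [s] now lie in [<[y]>]. As [P] is not cyclic, some other item [x] lies outside
   [<[y]>], and maximality of the order of [y] makes the two cyclic subgroups incomparable. *)
pose y := [arg max_(y > y0 | (false, y) \in s) #[y]].
have [s_y maxy]: (false, y) \in s /\ forall x, (false, x) \in s -> #[x] <= #[y].
  by rewrite /y; case: arg_maxnP => // i Pi maxi; split.
have [/allP ally|] := boolP (all (fun it => it.2 \in <[y]>) s).
  case/negP: ncP; apply: cyclicS (cycle_cyclic y); rewrite -defP gen_subG.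
  by apply/subsetP=> _ /[!inE] /mapP[it /ally + ->].
rewrite -has_predC => /hasP[[b x] s_x /= nyx].
have {b}s_x: (false, x) \in s by case: b s_x => // /az/(_ s_y); rewrite (negPf nyx).
have nxy: y \notin <[x]>.
  apply: contra nyx => xy; suff ->: <[y]> = <[x]> by apply: cycle_id.
  by apply/eqP; rewrite eqEcard cycle_subG xy -!orderE maxy.
have ne_xy: (false, x) != (false, y).
  by apply: contraNneq nxy => -[->]; apply: cycle_id.
pose K := <<[set x; y]>>%G.
have pK: 2.-group K.
  by apply: pgroupS pP; rewrite gen_subG subUset !sub1set (itP _ s_x) (itP _ s_y).
have perm_s: exists s1, perm_eq s [:: (true, z), (false, x), (false, y) & s1].
  have perm_s := perm_to_rem s_z; have memr u : (false, u) \in s -> (false, u) \in rem (true, z) s.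
    by rewrite (perm_mem perm_s) inE.
  exists (rem (false, y) (rem (false, x) (rem (true, z) s))).
  by apply: (perm_trans perm_s); rewrite perm_cons perm_to_rem2 ?memr.
case: perm_s => s1 perm_s.
apply: (@balanced_sub _ P s [:: (true, z); (false, x); (false, y)] s1) => //.
by apply: (balanced_central_involution pK) => //; rewrite ?az ?invP.
Qed.

Definition dihedral_with P (a b c : gT) := <<[set a; b]>> = P /\ c \in <[a * b]>.

(** If one of the involutions, or [a * b * c], lies in ['Phi(P)], then two of them generate [P], and
    ['Phi(P)] consists of rotations; hence the third is a rotation. Otherwise [hom2_notPhi3]
    applies. *)
Lemma three_involutions P (a b c : gT) : 2.-group P ->
    #[a] = 2 -> #[b] = 2 -> #[c] = 2 -> <<[set a; b; c]>> = P ->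
  [\/ exists2 chi, hom2 P chi & [&& chi a, chi b & chi c],
      dihedral_with P a b c, dihedral_with P a c b | dihedral_with P b c a].
Proof.
move=> pP oa ob oc defP.
have Pa: a \in P by rewrite -defP mem_gen // !inE eqxx.
have Pb: b \in P by rewrite -defP mem_gen // !inE eqxx orbT.
have Pc: c \in P by rewrite -defP mem_gen // !inE eqxx orbT.
have drop (u v w : gT) : [set a; b; c] = [set u; v; w] -> #[u] = 2 -> #[v] = 2 ->
    w \in <<[set u; v] :|: 'Phi(P)>> ->
  <<[set u; v]>> = P /\ 'Phi(P) \subset <[u * v]>.
  move=> Euvw ou ov Phiw; suff defP' : <<[set u; v]>> = P.
    by split=> //; apply: Phi_dihedral defP'.
  rewrite Euvw in defP; apply: Phi_sub_gen.
    rewrite -{1}defP gen_subG; apply/subsetP=> x; rewrite !inE -orbA.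
    by case/or3P=> /eqP-> //; rewrite mem_gen // !inE eqxx ?orbT.
  by rewrite -defP; apply: subset_trans (subset_gen _); apply: subsetUl.
have inPhi (u v w : gT) : [set a; b; c] = [set u; v; w] -> #[u] = 2 -> #[v] = 2 ->
    w \in 'Phi(P) -> dihedral_with P u v w.
  move=> Euvw ou ov Phiw.
  have [|? sPhi] := drop u v w Euvw ou ov; first by rewrite mem_gen // inE Phiw orbT.
  by split=> //; apply: subsetP sPhi _ Phiw.
have [Phic|nc] := boolP (c \in 'Phi(P)).
  by apply: Or42; apply: inPhi Phic.
have [Phib|nb] := boolP (b \in 'Phi(P)).
  by apply: Or43; apply: inPhi oa oc Phib; rewrite setUAC.
have [Phia|na] := boolP (a \in 'Phi(P)).
  by apply: Or44; apply: inPhi ob oc Phia; rewrite [RHS]setUC setUA.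
have [abc|nabc] := boolP (a * b * c \in 'Phi(P)); last first.
  by apply: Or41; apply: hom2_notPhi3.
apply: Or42; have def_c: c = (a * b)^-1 * (a * b * c) by rewrite mulKg.
have [|? sPhi] := drop a b c (erefl _) oa ob.
  rewrite def_c groupM ?groupV //; last by rewrite mem_gen // inE abc orbT.
  by rewrite groupM ?mem_gen // !inE eqxx ?orbT.
split=> //; rewrite def_c groupM ?groupV ?cycle_id //.
exact: subsetP sPhi _ abc.
Qed.

End TwoGroups.

(** * Sign words along the cosets of a cyclic group of odd order *)

Section Words.

Variables (gT : finGroupType) (y : gT).
Local Notation p := #[y].
Hypothesis odd_p : odd p.
Implicit Types (w u : gT -> bool) (S : gT -> 'F_3) (h g : gT).

(** Counting from [h * y ^+ k0], the positions [m - 1] and [m] both carry [s], and all other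
    neighbours alternate. For [m = 0], and likewise for [m = p], the repetition is between the last
    position and the first. *)
Definition alt_at (s : bool) w h k0 m := forall k, k < p ->
  w (h * y ^+ (k0 + k)) = s (+) odd k (+) odd m (+) (k < m).

(* Along the coset h<y> the signs alternate, except at one place where two
   consecutive signs are equal to s. *)
Definition near_alt s w h := exists k0, alt_at s w h k0 0.

(* The boundary S on the coset h<y> is compensated by signs on its y-edges. *)
Definition closable S h := exists k0 (d : nat -> bool), forall k, k < p ->
  (S (h * y ^+ (k0 + k))%g + sg (d k) - sg (d (if k is k'.+1 then k' else p.-1)) = 0)%R.

Lemma expg_pred_shift k m : y ^+ (k + p.-1 + m.+1) = y ^+ (k + m).
Proof.
have -> : k + p.-1 + m.+1 = k + m + p by have := order_gt0 y; lia.
by rewrite expgD expg_order mulg1.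
Qed.

Lemma alt_at_rebase s w h k0 : near_alt s w h ->
  exists2 m, m < p & alt_at s w h k0 m.
Proof.
(* The factor [p.-1] stands for -1, so [m] is [k1 - k0] modulo [p]. *)
case=> k1 w1; pose m := ((k1 + k0 * p.-1) %% p)%N.
have ltm: m < p by rewrite ltn_mod order_gt0.
have modk1 : y ^+ k1 = y ^+ (k0 + m).
  rewrite expgD expg_mod_order -expgD addnCA -{1}[k0]muln1 -mulnDr add1n prednK ?order_gt0 //.
  by rewrite expgD mulnC expgM expg_order expg1n mulg1.
exists m => // k ltk; have [lekm|ltmk] := ltnP k m.
  have -> : y ^+ (k0 + k) = y ^+ (k1 + (k + p - m)).
    rewrite [in RHS]expgD modk1 -expgD -addnA subnKC; last by lia.
    by rewrite addnA expgD expg_order mulg1.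
  rewrite w1 /= ?addbF; last by lia.
  by rewrite oddB ?oddD ?odd_p; [case: (s) (odd k) (odd m) => [] [] [] | lia].
have -> : y ^+ (k0 + k) = y ^+ (k1 + (k - m)).
  by rewrite [in RHS]expgD modk1 -expgD -addnA subnKC.
rewrite w1 /= ?addbF ?oddB //; last by lia.
by case: (s) (odd k) (odd m) => [] [] [].
Qed.

Lemma alt_at_shift s w h k0 m : m < p ->
  alt_at s w h k0 m -> alt_at s w h (k0 + p.-1) m.+1.
Proof.
have evp: odd p.-1 = false by move: odd_p; rewrite -{1}[p]prednK ?order_gt0 //= => /negPf.
move=> ltm altw [|k] ltk.
  have ltp: p.-1 < p by rewrite ltn_predL order_gt0.
  have nltm: p.-1 < m = false by lia.
  by rewrite addn0 altw //= evp nltm; case: (s) (odd m) => [] [].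
rewrite expg_pred_shift altw ?(ltn_trans _ ltk) // ltnS /=.
by case: (s) (odd k) (odd m) (k < m) => [] [] [] [].
Qed.

Lemma alt_at_order s w h k0 : alt_at s w h k0 p -> alt_at s w h k0 0.
Proof.
by move=> altw k ltk; rewrite altw // odd_p ltk /= addbF; case: (s) (odd k) => [] [].
Qed.

(** [phi] carries the coset of [h] to the coset of [phi h], keeping or reversing its cyclic
    direction. Right multiplication by an element that centralises or inverts [y] is the instance in
    view. *)
Definition twisted (phi : gT -> gT) h :=
  (forall i, phi (h * y ^+ i) = phi h * y ^+ i) \/
  (forall i, phi (h * y ^+ i) = phi h * y ^- i).

Lemma twist_expg k0 k : k < p ->
  y ^- ((k0 + p.-1) * p.-1 + k) = y ^+ (k0 + (p.-1 - k)).
Proof.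
move=> ltk; apply/eqP; rewrite eq_invg_mul -expgD; apply/eqP.
set n := k0 + p.-1; have -> : (n * p.-1 + k + (k0 + (p.-1 - k)) = n * p)%N.
  rewrite -[X in _ = (n * X)%N]prednK ?order_gt0 // mulnS /n; lia.
by rewrite mulnC expgM expg_order expg1n.
Qed.

Lemma near_alt_comp s w phi h :
  twisted phi h -> near_alt s w (phi h) -> near_alt s (fun g => w (phi g)) h.
Proof.
case=> tw [k0 altw].
  by exists k0 => k ltk; rewrite tw altw.
exists ((k0 + p.-1) * p.-1)%N => k ltk; rewrite tw twist_expg // altw; last by lia.
rewrite /= oddB; last by lia.
by move: odd_p; rewrite -{1}[p]prednK ?order_gt0 //= => /negPf->.
Qed.

(** When the direction is reversed, the edge leaving a position becomes the one entering its mirror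
    image, so the indices of [d] are reflected and its signs negated. *)
Lemma closable_comp S phi h :
  twisted phi h -> closable S (phi h) -> closable (fun g => S (phi g)) h.
Proof.
case=> tw [k0 [d dP]].
  by exists k0, d => k ltk; rewrite tw dP.
exists ((k0 + p.-1) * p.-1)%N.
exists (fun k => ~~ d (if p.-1 - k is j.+1 then j else p.-1)) => k ltk.
rewrite tw twist_expg // !sgN opprK addrAC.
have ltk': p.-1 - k < p by lia.
rewrite -[RHS](dP _ ltk'); congr (_ + sg (d _) - _)%R.
case: k ltk {ltk'} => [|k] ltk; first by rewrite subnn subn0.
by have -> : p.-1 - k = (p.-1 - k.+1).+1 by lia.
Qed.

Lemma expg_rebase i k0 k : y ^+ i * y ^+ (i * #[y].-1 + k0 + k) = y ^+ (k0 + k).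
Proof.
rewrite -expgD -addnA addnA -{1}[i]muln1 -mulnDr add1n prednK ?order_gt0 //.
by rewrite expgD mulnC expgM expg_order expg1n mul1g.
Qed.

Lemma near_alt_shift s w h i : near_alt s w h -> near_alt s w (h * y ^+ i).
Proof.
case=> k0 altw; exists (i * #[y].-1 + k0)%N => k ltk.
by rewrite -mulgA expg_rebase altw.
Qed.

Lemma closable_shift S h i : closable S h -> closable S (h * y ^+ i).
Proof.
case=> k0 [d dP]; exists (i * #[y].-1 + k0)%N, d => k ltk.
by rewrite -mulgA expg_rebase dP.
Qed.

Lemma near_alt_ext s w w' h : (forall i, w (h * y ^+ i) = w' (h * y ^+ i)) ->
  near_alt s w h -> near_alt s w' h.
Proof. by move=> E [k0 altw]; exists k0 => k ltk; rewrite -E altw. Qed.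

Lemma near_alt_addb s b w h :
  near_alt s w h -> near_alt (s (+) b) (fun g => w g (+) b) h.
Proof.
case=> k0 altw; exists k0 => k ltk; rewrite altw //.
by case: (s) (b) (odd k) => [] [] [].
Qed.

Lemma closable_ext S S' h : (forall i, S (h * y ^+ i) = S' (h * y ^+ i)) ->
  closable S h -> closable S' h.
Proof. by move=> E [k0 [d dP]]; exists k0, d => k ltk; rewrite -E dP. Qed.

Lemma closable_opp S h : closable S h -> closable (fun g => - S g)%R h.
Proof.
case=> k0 [d dP]; exists k0, (fun k => ~~ d k) => k ltk.
by rewrite !sgN -!opprD dP ?oppr0.
Qed.

(** Mod 3 the boundary is [u - w]. The words disagree exactly on the positions below [m] if [m] is
    even, and on those from [m] on if [m] is odd: an interval of even length on which both
    alternate. There [d] follows [w], and it is constant elsewhere, so it closes up. *)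
Lemma closable_majority s w u h : near_alt s w h -> near_alt s u h ->
  closable (fun g => sg (w g) + sg (w g) + sg (u g))%R h.
Proof.
case=> k0 altw /(alt_at_rebase k0)[m ltm altu].
exists k0, (fun k => if odd m (+) (k < m) then s (+) odd k else ~~ (s (+) odd m)).
have evp: odd p.-1 = false by move: odd_p; rewrite -{1}[p]prednK ?order_gt0 //= => /negPf.
move=> k ltk; rewrite altw // altu // /= ?addbF.
case: k ltk => [|k] ltk /=.
  have -> : p.-1 < m = false by lia.
  rewrite evp; case: (posnP m) => [->|_] /=.
    by case: (s); apply/val_inj.
  by case: (s) (odd m) => [] []; apply/val_inj.
have H : [&& (k.+1 < m) ==> (k < m) &
    (k < m) && ~~ (k.+1 < m) ==> (odd m == ~~ odd k)].
  have [ltkm|] := ltnP k.+1 m; first by rewrite (ltnW ltkm).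
  have [ltkm lemk|//] := ltnP k m.
  by have -> : m = k.+1 by [lia]; rewrite /= eqxx.
move: H; case: (s) (odd m) (odd k) (k < m) (k.+1 < m) => [] [] [] [] [] //= _;
  by apply/val_inj.
Qed.

(** Without the flip at [i] the boundary would be [2w - u], nonzero exactly on the interval of odd
    length where [w] and [u] agree, and so would not close up. The condition puts [i] outside that
    interval, where the flip supplies one more nonzero value of the right sign. *)
Lemma closable_flip k0 i m w z u h : odd i -> i < p -> 0 < m < p ->
    (if odd m then m <= i else i < m) ->
    alt_at false w h k0 0 ->
    (forall k, k < p -> z (h * y ^+ (k0 + k)) = odd k (+) (k == i)) ->
    alt_at false u h k0 m ->
  closable (fun g => sg (w g) + sg (z g) - sg (u g))%R h.
Proof.
move=> oddi lti /andP[gt0m ltm] cond altw altz altu.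
exists k0, (fun k => if odd m then (if k < m then odd k else i <= k)
                     else (if k < m then i <= k else odd k)).
have evp: odd p.-1 = false by move: odd_p; rewrite -{1}[p]prednK ?order_gt0 //= => /negPf.
move=> k ltk; rewrite altw // altz // altu // /= ?addbF.
case: k ltk => [|k] ltk /=.
  have -> : p.-1 < m = false by lia.
  have -> : i <= p.-1 by lia.
  have -> : (0 == i) = false by case: i oddi {lti cond altz}.
  have -> : i <= 0 = false by case: i oddi {lti cond altz}.
  by rewrite gt0m evp; case: (odd m); apply/val_inj.
have H1 : [&& (k.+1 < m) ==> (k < m) &
    (k < m) && ~~ (k.+1 < m) ==> (odd m == ~~ odd k)].
  have [ltkm|] := ltnP k.+1 m; first by rewrite (ltnW ltkm).
  have [ltkm lemk|//] := ltnP k m.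
  by have -> : m = k.+1 by [lia]; rewrite /= eqxx.
have H2 : [&& (i <= k) ==> (i <= k.+1), ~~ (i <= k) && (i <= k.+1) == (k.+1 == i)
    & (k.+1 == i) ==> ~~ odd k].
  apply/and3P; split; first by apply/implyP; lia.
    by rewrite -ltnNge; apply/eqP; apply/idP/idP; lia.
  by apply/implyP=> /eqP eq_i; move: oddi; rewrite -eq_i.
have H3 : if odd m then ((k < m) ==> ~~ (i <= k)) && ((k.+1 < m) ==> ~~ (i <= k.+1))
    else (~~ (k < m) ==> (i <= k)) && (~~ (k.+1 < m) ==> (i <= k)).
  by case: (odd m) cond => cond; apply/andP; split; apply/implyP; lia.
move: H1 H2 H3.
case: (odd m) (odd k) (k < m) (k.+1 < m) (i <= k) (i <= k.+1) (k.+1 == i)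
  => [] [] [] [] [] [] [] //= _ _ _; by apply/val_inj.
Qed.

Lemma coset_log h : exists L : gT -> nat, forall k, k < p -> L (h * y ^+ k) = k.
Proof.
exists (fun g => if [pick k : 'I_p | g == h * y ^+ k] is Some k then k : nat else 0).
move=> k ltk; case: pickP => [k' /eqP/mulgI/eqP|/(_ (Ordinal ltk))]; last by rewrite eqxx.
by rewrite eq_expg_mod_order !modn_small // => /eqP.
Qed.

Lemma closable_flip_ex u1 u2 h : 2 < p -> near_alt false u1 h -> near_alt false u2 h ->
  exists wz : (gT -> bool) * (gT -> bool), [/\ near_alt false wz.1 h,
    closable (fun g => sg (wz.1 g) + sg (wz.2 g) - sg (u1 g))%R h
  & closable (fun g => sg (wz.1 g) + sg (wz.2 g) - sg (u2 g))%R h].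
Proof.
move=> gt2p [k1 alt1] /(alt_at_rebase k1)[m ltm alt2].
(* One origin and one flip must serve both words. The origin is moved one or two places back so that
   neither repetition sits at position 0. *)
have [k0 [m1 [m2 [i [[oddi lti] [lt1 c1 a1] [lt2 c2 a2]]]]]] :
  exists k0 m1 m2 i, [/\ odd i /\ i < p,
    [/\ 0 < m1 < p, if odd m1 then m1 <= i else i < m1 & alt_at false u1 h k0 m1]
  & [/\ 0 < m2 < p, if odd m2 then m2 <= i else i < m2 & alt_at false u2 h k0 m2]].
  have gt1p: 1 < p := ltnW gt2p.
  have a1 := alt_at_shift (order_gt0 y) alt1; have a2 := alt_at_shift ltm alt2.
  case: (posnP m) => [m0|gt0m].
    rewrite m0 in a2; exists (k1 + p.-1 + p.-1), 2, 2, 1%N; rewrite gt1p gt2p.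
    by split=> //; split=> //; apply: alt_at_shift.
  have [ltm1|lepm] := ltnP m.+1 p.
    case: (boolP (odd m.+1)) => oddm; last first.
      by exists (k1 + p.-1), 1%N, m.+1, 1%N; rewrite (negPf oddm) gt1p ltm1; split.
    (* The flip is placed at [p - 2], the largest odd position, to be at or beyond the odd
       [m.+1]. *)
    have [n def_p] : exists n, p = n.+3 by exists (p - 3); lia.
    have leqn: m.+1 <= n.+1.
      rewrite def_p !ltnS leq_eqVlt in ltm1; case/predU1P: ltm1 => [eq_m|//].
      by move: odd_p oddm; rewrite def_p eq_m /= negbK => ->.
    exists (k1 + p.-1), 1%N, m.+1, n.+1; rewrite oddm gt1p ltm1; split; split=> //.
      by move: odd_p; rewrite def_p /= negbK.
    by rewrite def_p.
  have mp: m.+1 = p by apply/eqP; rewrite eqn_leq ltm lepm.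
  rewrite mp in a2; have {}a2 := alt_at_order a2.
  exists (k1 + p.-1 + p.-1), 2, 1%N, 1%N; rewrite gt1p gt2p.
  by split=> //; split=> //; apply: alt_at_shift; rewrite ?order_gt0.
have [L LP] := coset_log (h * y ^+ k0).
have LPk k : k < p -> L (h * y ^+ (k0 + k)) = k by move=> ltk; rewrite expgD mulgA LP.
exists (fun g => odd (L g), fun g => odd (L g) (+) (L g == i)) => /=.
have altL: alt_at false (fun g => odd (L g)) h k0 0.
  by move=> k ltk; rewrite LPk //= addbF addbF.
have zL k : k < p -> (fun g => odd (L g) (+) (L g == i)) (h * y ^+ (k0 + k)) =
    odd k (+) (k == i) by move=> ltk; rewrite /= LPk.
split; first by exists k0.
  exact: closable_flip oddi lti lt1 c1 altL zL a1.
exact: closable_flip oddi lti lt2 c2 altL zL a2.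
Qed.

Lemma near_alt_ex : exists w, forall h, near_alt false w h.
Proof.
have /fin_all_exists[L LP] : forall h : gT, exists L : gT -> nat,
  forall k, k < p -> L (h * y ^+ k) = k by move=> h; apply: coset_log.
exists (fun g => odd (L (repr (g *: <[y]>)) g)) => h.
set r := repr (h *: <[y]>).
have: r \in h *: <[y]> by apply: mem_repr (lcoset_refl _ h).
case/lcosetP=> _ /cycleP[k0 ->] def_r; exists k0 => k ltk.
have -> : (h * y ^+ (k0 + k)) *: <[y]> = h *: <[y]> by rewrite lcosetM lcoset_id ?mem_cycle.
by rewrite -/r expgD mulgA -def_r LP //= !addbF.
Qed.

Lemma closable_glue (G : {group gT}) S : y \in G ->
    {in G, forall h, closable S h} ->
  exists d : gT -> bool, {in G, forall g,
    (S g + (sg (d g) - sg (d (g * y^-1)%g)) = 0)%R}.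
Proof.
move=> Gy cl.
have /fin_all_exists[d dP] : forall h : gT, exists d : gT -> bool, h \in G -> forall i,
    (S (h * y ^+ i)%g + (sg (d (h * y ^+ i)%g) - sg (d (h * y ^+ i * y^-1)%g)) = 0)%R.
  move=> h; case Gh: (h \in G); last by exists xpredT.
  have [k0 [d dP]] := cl h Gh; have [L LP] := coset_log (h * y ^+ k0).
  exists (fun g => d (L g)) => _ i.
  have: y ^+ i \in <[y]> by rewrite mem_cycle.
  rewrite -[y ^+ i](mulKVg (y ^+ k0)) groupMl ?mem_cycle // => /cyclePmin[k ltk ->].
  rewrite mulgA LP // -mulgA -expgD; have := dP k ltk; rewrite addrA.
  congr (_ + _ - sg (d _) = _)%R; symmetry; case: k ltk => [|k] ltk.
    rewrite addn0 -[p.-1]LP ?prednK ?order_gt0 //; congr (L _).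
    by rewrite -!mulgA -{1}(mulgK y (_ ^+ p.-1)) -expgSr prednK ?order_gt0 // expg_order mul1g.
  by rewrite addnS expgSr mulgA mulgK expgD mulgA LP // ltnW.
exists (fun g => d (repr (g *: <[y]>)) g) => g Gg.
have -> : (g * y^-1) *: <[y]> = g *: <[y]> by rewrite lcosetM lcoset_id ?groupV ?cycle_id.
set r := repr _; have: r \in g *: <[y]> by apply: mem_repr (lcoset_refl _ g).
case/lcosetP=> t ty def_r.
have Gr: r \in G by rewrite def_r groupM // (subsetP _ _ ty) // cycle_subG.
have /cycleP[i def_t]: t^-1 \in <[y]> by rewrite groupV.
by have := dP r Gr i; rewrite -def_t {1 3 5}def_r mulgK.
Qed.

End Words.

(** * Three involutions and a cycle *)

Lemma twisted_mulr (gT : finGroupType) (y t h : gT) :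
  (y ^ t == y) || (y ^ t == y^-1) -> twisted y (mulg^~ t) h.
Proof.
move=> yt; have tw i : h * y ^+ i * t = h * t * (y ^ t) ^+ i.
  by rewrite -!mulgA [y ^+ i * t]conjgC conjXg.
by case/orP: yt => /eqP yt; [left | right] => i; rewrite /= tw yt // expVgn.
Qed.

(** The repeated sign of the word over position [k] of the cycle of length [2q]. For even [q] it
    alternates around the cycle except at the steps from 0 to 1 and from [q] to [q + 1]. *)
Definition ladder_sign q k := if k == 0 then false else if k < q then ~~ odd k
  else if k == q then true else odd k.

Lemma ladder_sign_up q k : ~~ odd q -> 1 < q -> k < q.*2 -> k != 0 -> k != q ->
  ~~ ladder_sign q (if k.+1 == q.*2 then 0 else k.+1) = ladder_sign q k.
Proof.
move=> evq gt1q ltk n0 nq; case: eqP => [eq2q|ne2q];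
  rewrite /ladder_sign (negPf n0) (negPf nq) /=.
  have -> : k < q = false by have := addnn q; lia.
  by apply/esym; move: (odd_double q); rewrite -eq2q /= => /negbFE.
case: (ltngtP k.+1 q) => cmp; case: (ltngtP k q) nq => // cmp' _; lia.
Qed.

Lemma half_turn_lo k q : k < q ->
  [/\ (k + q == 0) = false, (k + q < q) = false, (k + q == q) = (k == 0)
    & (k == q) = false].
Proof. by move=> ltk; split; lia. Qed.

Lemma half_turn_hi k q : 0 < q -> q <= k < q.*2 ->
  [/\ (k == 0) = false, (k - q == 0) = (k == q), (k - q == q) = false & k - q < q].
Proof. by rewrite -addnn => gt0q /andP[leqk ltk]; split; lia. Qed.

Section Ladder.

Variables (gT : finGroupType) (G : {group gT}) (a b c y : gT).
Variables (q : nat) (pos : gT -> nat).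
Hypotheses (Ga : a \in G) (Gb : b \in G) (Gc : c \in G) (Gy : y \in G).
Hypotheses (aa : a * a = 1) (bb : b * b = 1) (cc : c * c = 1).
Hypotheses (odd_p : odd #[y]) (gt2p : 2 < #[y]).
Hypotheses (ya : (y ^ a == y) || (y ^ a == y^-1)).
Hypotheses (yb : (y ^ b == y) || (y ^ b == y^-1)).
Hypotheses (yc : (y ^ c == y) || (y ^ c == y^-1)).
Hypotheses (even_q : ~~ odd q) (gt1q : 1 < q).
Hypothesis pos_lt : {in G, forall g, pos g < q.*2}.
Hypothesis pos_y : {in G, forall g, pos (g * y) = pos g}.
Hypothesis pos_a : {in G, forall g,
  pos (g * a) = if odd (pos g) then (pos g).-1 else (pos g).+1}.
Hypothesis pos_b : {in G, forall g, pos (g * b) =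
  if odd (pos g) then (if (pos g).+1 == q.*2 then 0 else (pos g).+1)
  else (if pos g == 0 then q.*2.-1 else (pos g).-1)}.
Hypothesis pos_c : {in G, forall g,
  pos (g * c) = if pos g < q then pos g + q else pos g - q}.

(* Modulo <y>, the graph is a covering of the Moebius ladder with rungs c on a
   cycle of length 2q that is traversed alternately by a and b. The vertices
   over 0 and q are the only ones that are not sources or sinks mod 3. *)
Lemma balanced_ladder : balanced G [:: (true, a); (true, b); (true, c); (false, y)].
Proof.
have [WB WBP] := near_alt_ex y.
have tw t h : (y ^ t == y) || (y ^ t == y^-1) -> twisted y (mulg^~ t) h.
  exact: twisted_mulr.
have WBa h : near_alt y false (fun g => WB (g * a)) h.
  exact: (near_alt_comp odd_p (tw a h ya) (WBP _)).
have WBcac h : near_alt y false (fun g => WB (g * c * a * c)) h.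
  apply: (near_alt_comp odd_p (tw c h yc) (w := fun g => WB (g * a * c))) => /=.
  apply: (near_alt_comp odd_p (tw a _ ya) (w := fun g => WB (g * c))) => /=.
  exact: (near_alt_comp odd_p (tw c _ yc) (WBP _)).
(* The rung over 0 and [q] shares its signs between both ends, so one pair of words must close up
   against the [a]-neighbour of each end. Seen from the end over 0, these are the words at [g * a]
   and [g * c * a * c]. *)
have /fin_all_exists[W WP] h := closable_flip_ex odd_p gt2p (WBa h) (WBcac h).
pose r g := repr (g *: <[y]>).
have rM g i : r (g * y ^+ i) = r g by rewrite /r lcosetM lcoset_id ?mem_cycle.
have rI h : exists i, h = r h * y ^+ i.
  have: r h \in h *: <[y]> by apply: mem_repr (lcoset_refl _ h).
  case/lcosetP=> t ty def_r; have /cycleP[i def_t]: t^-1 \in <[y]> by rewrite groupV.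
  by exists i; rewrite -def_t def_r mulgK.
pose WA g := (W (r g)).1 g; pose Wz g := (W (r g)).2 g.
have rr h : r (r h) = r h by have [i {2}->] := rI h; rewrite rM.
have WAP h : near_alt y false WA h.
  have [i ->] := rI h; apply: near_alt_shift.
  have [altW _ _] := WP (r h); apply: near_alt_ext altW => j.
  by rewrite /WA rM rr.
have clA h : closable y (fun g => sg (WA g) + sg (Wz g) - sg (WB (g * a)%g))%R h.
  have [i ->] := rI h; apply: closable_shift.
  have [_ clW _] := WP (r h); apply: closable_ext clW => j.
  by rewrite /WA /Wz rM rr.
have clC h : closable y (fun g => sg (WA g) + sg (Wz g) - sg (WB (g * c * a * c)%g))%R h.
  have [i ->] := rI h; apply: closable_shift.
  have [_ _ clW] := WP (r h); apply: closable_ext clW => j.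
  by rewrite /WA /Wz rM rr.
(* [Phi h] is the value leaving [h] towards the preceding position of the cycle and, unless [h] lies
   over 0 or [q], also along the rung [c]. The two ends of a rung have opposite [Phi]. *)
pose Phi h := if pos h == 0 then WA h else if pos h < q then WB h (+) ~~ odd (pos h)
  else if pos h == q then ~~ WA (h * c) else WB (h * c) (+) odd (pos h).
have pos_yX g i : g \in G -> pos (g * y ^+ i) = pos g.
  move=> Gg; elim: i => [|i IHi]; first by rewrite mulg1.
  by rewrite expgSr mulgA pos_y ?groupM ?groupX.
have PhiP h : h \in G -> near_alt y (ladder_sign q (pos h)) Phi h.
  move=> Gh; rewrite /ladder_sign /Phi.
  case: eqP => [p0|n0]; first by apply: near_alt_ext (WAP h) => i; rewrite pos_yX ?p0.
  have WBc: near_alt y false (fun g => WB (g * c)) h.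
    exact: (near_alt_comp odd_p (tw c h yc) (WBP _)).
  have WAc: near_alt y false (fun g => WA (g * c)) h.
    exact: (near_alt_comp odd_p (tw c h yc) (WAP _)).
  case: ifP => ltq.
    apply: near_alt_ext (near_alt_addb (~~ odd (pos h)) (WBP h)) => i.
    by rewrite pos_yX // ltq; case: eqP.
  case: eqP => [eqq|neq].
    apply: near_alt_ext (near_alt_addb true WAc) => i.
    by rewrite pos_yX // ltq -eqq eqxx addbT; case: eqP.
  apply: near_alt_ext (near_alt_addb (odd (pos h)) WBc) => i.
  by rewrite pos_yX // ltq; case: eqP => //; case: eqP.
have pos_a_odd g : g \in G -> odd (pos (g * a)) = ~~ odd (pos g).
  move=> Gg; rewrite pos_a //; case: ifP => oddg; last by rewrite /= oddg.
  by case: (pos g) oddg => //= n /negPf->.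
have pos_b_odd g : g \in G -> odd (pos (g * b)) = ~~ odd (pos g).
  move=> Gg; rewrite pos_b //; case: ifP => oddg.
    by case: ifP => //= _; rewrite oddg.
  case: eqP => [_|]; first by rewrite -subn1 oddB ?odd_double ?double_gt0 ?(ltnW gt1q).
  by case: (pos g) oddg => //= n /negbFE->.
pose fa h := if odd (pos h) then Phi h else ~~ Phi (h * a).
pose fb h := if odd (pos h) then ~~ Phi (h * b) else Phi h.
pose fc h := if pos h == 0 then Wz h else if pos h == q then ~~ Wz (h * c) else Phi h.
have faP g : g \in G -> fa (g * a) = ~~ fa g.
  move=> Gg; rewrite /fa pos_a_odd // -mulgA aa mulg1.
  by case: (odd (pos g)) => //=; rewrite negbK.
have fbP g : g \in G -> fb (g * b) = ~~ fb g.
  move=> Gg; rewrite /fb pos_b_odd // -mulgA bb mulg1.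
  by case: (odd (pos g)) => //=; rewrite negbK.
have fcP g : g \in G -> fc (g * c) = ~~ fc g.
  move=> Gg; rewrite /fc pos_c // /Phi -!mulgA cc mulg1 pos_c //.
  have [ltq|leq] := ltnP (pos g) q.
    have [-> -> -> ->] := half_turn_lo ltq.
    by case: eqP => // _; rewrite oddD (negPf even_q) addbF addbN negbK.
  have [|-> -> -> ->] := half_turn_hi (k := pos g) (ltnW gt1q).
    by rewrite leq pos_lt.
  case: eqP => // _; first by rewrite negbK.
  by rewrite oddB // (negPf even_q) addbF addbN.
pose S g := (sg (fa g) + sg (fb g) + sg (fc g))%R.
have clS : {in G, forall h, closable y S h}.
  move=> h Gh; have Gi i : h * y ^+ i \in G by rewrite groupM ?groupX.
  case: (eqVneq (pos h) 0) => [p0|n0].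
    apply: closable_ext (clA h) => i; rewrite /S /fa /fb /fc !pos_yX // p0 /=.
    rewrite sgN /Phi pos_a // !pos_yX // p0 /= gt1q addbF.
    by ring.
  case: (eqVneq (pos h) q) => [pq|nq].
    have cl1 := closable_comp odd_p (tw c h yc) (clC _).
    apply: closable_ext (closable_opp cl1) => i; rewrite /S /fa /fb /fc !pos_yX // pq.
    rewrite (negPf even_q) eqxx; have -> : (q == 0) = false by rewrite eqn0Ngt (ltnW gt1q).
    rewrite !sgN /Phi pos_a // !pos_yX // pq (negPf even_q) eqxx ltnn ltnNge leqnSn /=.
    have -> : (q == 0) = false by rewrite eqn0Ngt (ltnW gt1q).
    have -> : (q.+1 == q) = false by rewrite gtn_eqF.
    rewrite even_q addbT !sgN -![_ * c * c]mulgA cc mulg1.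
    by ring.
  (* Away from 0 and [q] the boundary is twice [Phi h] minus [Phi] at the next position, and both
     words repeat the same sign, as [closable_majority] requires. *)
  pose up g := if odd (pos g) then g * b else g * a.
  have Gup : up h \in G by rewrite /up; case: ifP => _; rewrite groupM.
  have near_up : near_alt y (ladder_sign q (pos h)) (fun g => ~~ Phi (up g)) h.
    have tw_up: twisted y up h.
      case: (boolP (odd (pos h))) => oddh.
        by have [] := tw b h yb => tw1; [left | right] => i; rewrite /up pos_yX // oddh tw1.
      have [] := tw a h ya => tw1; [left | right] => i;
        by rewrite /up pos_yX // (negPf oddh) tw1.
    have := near_alt_comp odd_p tw_up (PhiP _ Gup).
    move/(near_alt_addb true); rewrite addbT.
    have -> : ~~ ladder_sign q (pos (up h)) = ladder_sign q (pos h).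
      rewrite -(ladder_sign_up even_q gt1q (pos_lt Gh) n0 nq) /up.
      case: ifP => oddh; rewrite ?pos_b ?pos_a // oddh //.
      by case: eqP oddh => // eq2q; move: (odd_double q); rewrite -eq2q /= => /negbFE->.
    by apply: near_alt_ext => i; rewrite addbT.
  apply: closable_ext (closable_majority odd_p (PhiP h Gh) near_up) => i.
  rewrite /S /fa /fb /fc /up !pos_yX // (negPf n0) (negPf nq).
  by case: ifP => _; rewrite ?sgN; ring.
have [d dP] := closable_glue Gy clS.
exists (fun g => sg (fa g)); first by exists fa => g Gg; rewrite faP.
exists (fun g => sg (fb g)); first by exists fb => g Gg; rewrite fbP.
exists (fun g => sg (fc g)); first by exists fc => g Gg; rewrite fcP.
exists (fun g => sg (d g) - sg (d (g * y^-1)%g))%R; first by exists d.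
move=> g Gg; have := dP g Gg; rewrite /S => eq0.
by rewrite sub0r -!opprD eq0 oppr0.
Qed.

End Ladder.

(** Conjugation by [t] is the [k]-th power map on [<[y]>], with [k] squared congruent to 1 modulo
    the prime order, so [k] is 1 or -1. *)
Lemma conj_involution_prime (gT : finGroupType) (y t : gT) :
    prime #[y] -> t * t = 1 -> y ^ t \in <[y]> ->
  (y ^ t == y) || (y ^ t == y^-1).
Proof.
move=> pr_y tt /cyclePmin[k ltk def_k].
have ntk: 0 < k.
  rewrite lt0n; apply/eqP=> k0; have: y ^ t == 1 by rewrite def_k k0 expg0.
  by rewrite conjg_eq1 -order_eq1; case: #[y] pr_y => [|[]].
have: y == y ^+ (k * k).
  by rewrite expgM -!def_k -conjXg -def_k -conjgM tt conjg1.
rewrite -{1}[y]expg1 eq_expg_mod_order eq_sym eqn_mod_dvd ?muln_gt0 ?ntk //.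
have -> : (k * k - 1 = (k - 1) * (k + 1))%N.
  by case: k ntk {ltk def_k} => // k _; rewrite subSS subn0 mulSn mulnS; lia.
rewrite Euclid_dvdM // def_k => /orP[] dvk; apply/orP; [left|right].
  case: (posnP (k - 1)) => [k1|gt0k]; last by have := dvdn_leq gt0k dvk; lia.
  by have -> : k = 1%N by [lia]; rewrite expg1.
by rewrite eq_sym eq_invg_mul -expgS -addn1 -order_dvdn.
Qed.

Section LadderQuotient.

Variables (gT : finGroupType) (G N : {group gT}) (a b c y : gT).
Hypotheses (nsNG : N <| G) (Ga : a \in G) (Gb : b \in G) (Gc : c \in G).
Hypotheses (oa : #[a] = 2) (ob : #[b] = 2) (oc : #[c] = 2).
Hypotheses (oa' : #[coset N a] = 2) (ob' : #[coset N b] = 2) (oc' : #[coset N c] = 2).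
Hypothesis dih : dihedral_with (G / N)%G (coset N a) (coset N b) (coset N c).
Hypotheses (Ny : y \in N) (pr_y : prime #[y]) (odd_y : odd #[y]) (nsyG : <[y]> <| G).

Lemma balanced_dihedral_quotient :
  balanced G [:: (true, a); (true, b); (true, c); (false, y)].
Proof.
have [defP rc] := dih; have nNG := subsetP (normal_norm nsNG).
have sq (x : gT) : #[x] = 2 -> x * x = 1.
  by move=> ox; have := expg_order x; rewrite ox.
have Gy: y \in G by apply: subsetP (normal_sub nsNG) _ Ny.
have conj_y t : #[t] = 2 -> t \in G -> (y ^ t == y) || (y ^ t == y^-1).
  move=> ot Gt; apply: conj_involution_prime; rewrite ?sq //.
  have /andP[_ /subsetP/(_ t Gt)] := nsyG.
  by move/normP=> <-; rewrite memJ_conjg cycle_id.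
set r := coset N a * coset N b in rc.
have [nRa sR iR] := dihedral_index2 oa' ob'; rewrite defP -/r in nRa sR iR.
have homR := index2_hom2 sR iR.
have aa: coset N a * coset N a = 1 by have := expg_order (coset N a); rewrite oa'.
have bb: coset N b * coset N b = 1 by have := expg_order (coset N b); rewrite ob'.
have Va: (coset N a)^-1 = coset N a by apply: order2V.
have Vb: (coset N b)^-1 = coset N b by apply: order2V.
have nRb: coset N b \notin <[r]>.
  apply: contra nRa => Rb.
  by rewrite -[coset N a](mulgK (coset N b)) groupM ?groupV // cycle_id.
set q := #[r].
have [m ltm def_c] := cyclePmin rc.
(* An involution in [<[r]>] can only be the half turn; hence [c] shifts positions by [q] on the
   cycle of length [2q]. *)
have q2 : q = m.*2.
  have cc: coset N c * coset N c = 1 by have := expg_order (coset N c); rewrite oc'.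
  have: q %| m + m by rewrite order_dvdn expgD -def_c cc.
  have gt0m: 0 < m.
    by rewrite lt0n; apply/eqP=> m0; have := oc'; rewrite def_c m0 order1.
  case/dvdnP=> k eq_k; rewrite -addnn; move: ltm gt0m eq_k; rewrite -/q.
  by move: (q) => q1; clear; case: k => [|[|k]]; rewrite ?mul1n ?mulSn; lia.
have gt0m: 0 < m by rewrite -double_gt0 -q2 order_gt0.
have [L LP] := coset_log r 1.
have Lr k : L (r ^+ k) = (k %% q)%N.
  by rewrite -expg_mod_order -[r ^+ _]mul1g LP // ltn_mod order_gt0.
(* Modulo [N], the rotation [r ^+ k] sits at position [2k] and the reflection [r ^+ k * a] at
   [2k + 1]. *)
pose pos g := if coset N g \in <[r]> then (L (coset N g)).*2
              else (L (coset N g * coset N a)).*2.+1.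
have cN g h : g \in G -> h \in G -> coset N (g * h) = coset N g * coset N h.
  by move=> Gg Gh; rewrite morphM ?nNG.
have inP g : g \in G -> coset N g \in (G / N)%G by move=> Gg; apply: mem_quotient.
have homg g x : g \in G -> x \in (G / N)%G -> x \notin <[r]> ->
    (coset N g * x \in <[r]>) = (coset N g \notin <[r]>).
  move=> Gg Px nRx; have := homR _ _ (inP g Gg) Px; rewrite nRx addbT.
  by move=> E; rewrite -[LHS]negbK E negbK.
have posE g : g \in G -> exists2 k, k < q &
    (coset N g = r ^+ k /\ pos g = k.*2) \/
    (coset N g \notin <[r]> /\ coset N g * coset N a = r ^+ k /\ pos g = k.*2.+1).
  move=> Gg; rewrite /pos; case: ifP => [/cyclePmin[k ltk def_g]|nRg].
    by exists k => //; left; rewrite def_g Lr modn_small.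
  have /cyclePmin[k ltk def_g]: coset N g * coset N a \in <[r]>.
    by rewrite homg ?inP // nRg.
  by exists k => //; right; rewrite def_g Lr modn_small.
have pos_in g k : g \in G -> coset N g = r ^+ k -> pos g = (k %% q)%N.*2.
  by move=> Gg def_g; rewrite /pos def_g mem_cycle Lr.
have pos_out g k : g \in G -> coset N g * coset N a = r ^+ k -> pos g = (k %% q)%N.*2.+1.
  move=> Gg def_g; rewrite /pos; have := homg g _ Gg (inP a Ga) nRa.
  by rewrite def_g mem_cycle => /esym/negPf->; rewrite Lr.
have ca: coset N c * coset N a = coset N a * coset N c.
  have ra: r ^ coset N a = r^-1.
    by rewrite conjgE Va /r !mulgA aa mul1g invMg Va Vb.
  have: coset N c ^ coset N a = coset N c.
    by rewrite def_c conjXg ra expVgn -def_c (order2V oc').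
  by rewrite conjgC => ->.
have gtq: 0 < q by apply: order_gt0.
apply: (@balanced_ladder _ G a b c y q pos) => //; rewrite ?sq ?conj_y //.
- by case: #[y] pr_y odd_y => [|[|[]]].
- by rewrite q2 odd_double.
- by rewrite q2; case: (m) gt0m.
- move=> g Gg; have [k ltk [[_ ->]|[_ [_ ->]]]] := posE g Gg.
    by rewrite ltn_double.
  by rewrite ltn_Sdouble.
- move=> g Gg; have E: coset N (g * y) = coset N g by rewrite coset_kerr.
  by rewrite /pos E.
- move=> g Gg; have [k ltk [[def_g ->]|[_ [def_g ->]]]] := posE g Gg.
    rewrite odd_double (@pos_out _ k) ?groupM ?modn_small //.
    by rewrite cN // -mulgA aa mulg1.
  by rewrite /= odd_double /= (@pos_in _ k) ?groupM ?modn_small // cN.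
- move=> g Gg; have [k ltk [[def_g ->]|[_ [def_g ->]]]] := posE g Gg.
    (* Since [b] is the inverse of [r] times [a], it sends [r ^+ k] to the reflection of index
       [k - 1], and [q.-1] plays the role of -1. *)
    rewrite odd_double (@pos_out _ (k + q.-1)) ?groupM //; last first.
      rewrite cN // def_g -mulgA expgD; congr (_ * _).
      apply/eqP; rewrite -Va -Vb -invMg -/r eq_invg_mul -expgS prednK //.
      by rewrite expg_order.
    rewrite double_eq0; case: k ltk {def_g} => [|k] ltk /=.
      by rewrite add0n modn_small ?ltn_predL // -{2}(prednK gtq) doubleS.
    rewrite addSnnS prednK // modnDr modn_small ?(ltnW ltk) //.
  rewrite /= odd_double /= (@pos_in _ k.+1) ?groupM //; last first.
    by rewrite cN // expgSr -def_g /r !mulgA -[_ * coset N a * coset N a]mulgA aa mulg1.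
  rewrite -doubleS (inj_eq double_inj) eqn_leq.
  case: (eqVneq k.+1 q) => [->|nek]; first by rewrite leqnn modnn.
  have ltk1: k.+1 < q by rewrite ltn_neqAle nek.
  by rewrite modn_small // [q <= _]leqNgt ltk1 andbF.
move=> g Gg; have [k ltk [[def_g ->]|[_ [def_g ->]]]] := posE g Gg.
  rewrite (@pos_in _ (k + m)) ?groupM //; last by rewrite cN // def_g def_c expgD.
  rewrite {2}q2 ltn_double; case: ltnP => [ltkm|lemk].
    by rewrite modn_small ?q2 -?doubleD // -addnn ltn_add2r.
  rewrite -(subnK lemk) -addnA addnn -q2 modnDr modn_small ?(leq_ltn_trans (leq_subr _ _)) //.
  by rewrite doubleD q2 addnK.
rewrite (@pos_out _ (k + m)) ?groupM //; last first.
  by rewrite cN // -mulgA ca mulgA def_g def_c expgD.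
rewrite {2}q2 ltn_Sdouble; case: ltnP => [ltkm|lemk].
  by rewrite modn_small ?q2 ?addSn -?doubleD // -addnn ltn_add2r.
rewrite -(subnK lemk) -addnA addnn -q2 modnDr modn_small ?(leq_ltn_trans (leq_subr _ _)) //.
by rewrite doubleD q2 -addSn addnK.
Qed.

End LadderQuotient.

(** * Reduction modulo a normal subgroup of odd order *)

Section Quotients.

Variable gT : finGroupType.
Implicit Types (G N L M : {group gT}) (s : seq (bool * gT)).

Definition outside N s := [seq it <- s | it.2 \notin N].
Definition quo N s := [seq (it.1, coset N it.2) | it <- outside N s].

Lemma odd_order2 N (a : gT) : odd #|N| -> #[a] = 2 -> a \notin N.
Proof.
move=> oddN oa; apply: contraL oddN => Na.
by rewrite -dvdn2 -oa; apply: order_dvdG.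
Qed.

Lemma order2_coset G N (a : gT) : N <| G -> a \in G -> #[a] = 2 -> a \notin N ->
  #[coset N a] = 2.
Proof.
case/andP=> _ nNG Ga oa nNa; have Na := subsetP nNG a Ga.
apply/prime_nt_dvdP => //; last by rewrite -oa morph_order.
by rewrite order_eq1; apply: contra nNa => /eqP/coset_idr->.
Qed.

Lemma perm_outside N s : perm_eq s (outside N s ++ [seq it <- s | it.2 \in N]).
Proof.
by rewrite /outside perm_sym perm_catC perm_filterC.
Qed.

Lemma valid_quo G N s : N <| G -> valid G s -> valid (G / N) (quo N s).
Proof.
move=> nsNG vs; apply/allP=> _ /mapP[it + ->]; rewrite mem_filter => /andP[nNit s_it].
have /andP[Git oit] := allP vs it s_it; rewrite /= mem_quotient //=.
case: it.1 oit => [/eqP oit|_]; first by rewrite (order2_coset nsNG).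
by apply: contra nNit => /eqP/coset_idr->; rewrite ?(subsetP (normal_norm nsNG)).
Qed.

Lemma gens_quo G N s : N <| G -> <<gens s>> = G -> <<gens (quo N s)>> = G / N.
Proof.
move=> nsNG defG; have nNG := normal_norm nsNG.
have sG: gens s \subset G by rewrite -defG subset_gen.
rewrite -defG quotient_gen ?(subset_trans sG) //; apply/eqP; rewrite eqEsubset.
apply/andP; split; rewrite gen_subG; apply/subsetP=> x.
  rewrite inE => /mapP[_ /mapP[it + ->] ->] /=; rewrite mem_filter => /andP[_ s_it].
  have s_x: it.2 \in gens s by rewrite inE map_f.
  by apply: mem_gen; apply: mem_morphim (subsetP nNG _ (subsetP sG _ s_x)) s_x.
case/morphimP=> g Ng; rewrite inE => /mapP[it s_it def_g] -> /=.
case Nit: (it.2 \in N); first by rewrite def_g coset_id ?group1.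
rewrite mem_gen // inE; apply/mapP; exists (it.1, coset N g) => //.
by apply/mapP; exists it; rewrite ?def_g // mem_filter Nit.
Qed.

Lemma count_outside G N s : odd #|N| -> valid G s ->
  count fst (outside N s) = count fst s /\ count fst (quo N s) = count fst s.
Proof.
move=> oddN vs; have E: count fst (outside N s) = count fst s.
  rewrite count_filter; apply: eq_in_count => it s_it /=.
  have /andP[_] := allP vs it s_it; case: it.1 => //= /eqP oit.
  exact: odd_order2.
by split=> //; rewrite /quo count_map -E; apply: eq_count.
Qed.

Lemma balanced_outside G N s : odd #|N| -> valid G s -> odd (count fst s) ->
  balanced G (outside N s) -> balanced G s.
Proof.
move=> oddN vs odds; have [eqc _] := count_outside oddN vs.
move=> bo; apply: balanced_sub (perm_outside N s) vs (odds) _ bo.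
by rewrite eqc.
Qed.

Lemma balanced_quo G N s : N <| G -> odd #|N| -> valid G s -> odd (count fst s) ->
  balanced (G / N) (quo N s) -> balanced G s.
Proof.
move=> nsNG oddN vs odds bq; apply: (balanced_outside oddN vs odds).
apply: balanced_quotient nsNG _ bq => it; rewrite mem_filter => /andP[_ s_it].
by case/andP: (allP vs it s_it).
Qed.

Lemma valency_quo N s : valency (quo N s) = valency (outside N s).
Proof. by rewrite /valency big_map. Qed.

Lemma valency_cons it s : valency (it :: s) = ((if it.1 then 1 else 2) + valency s)%N.
Proof. by rewrite /valency big_cons. Qed.

Variant small_items_spec s : Prop :=
  | SmallInv a of s = [:: (true, a)]
  | SmallInvPair a x of s = [:: (true, a); (false, x)]
  | SmallPairInv a x of s = [:: (false, x); (true, a)]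
  | SmallInv3 a b c of s = [:: (true, a); (true, b); (true, c)].

Lemma small_items s : valency s <= 4 -> odd (count fst s) -> small_items_spec s.
Proof.
case: s => [|[[] a] [|[[] b] [|[[] c] [|[[] d] [|[[] e] s]]]]];
  rewrite ?valency_cons //= => val4 odds; try lia.
- exact: (SmallInv (erefl _)).
- exact: (SmallInv3 (erefl _)).
- exact: (SmallInvPair (erefl _)).
- exact: (SmallPairInv (erefl _)).
Qed.

(** All involutions lie outside [N]. With valency at least 5 there, [balanced_2group] applies in
    [G / N]. Otherwise the valency there, being odd, is at most 3, and the lists are enumerated;
    only the dihedral case needs [y]. *)
Lemma balanced_core G N s : N <| G -> odd #|N| ->
    2.-group (G / N) -> ~~ cyclic (G / N) ->
    valid G s -> <<gens s>> = G -> odd (count fst s) ->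
    4 < valency (outside N s) \/
    (exists y, [/\ (false, y) \in s, y \in N, prime #[y] & <[y]> <| G]) ->
  balanced G s.
Proof.
move=> nsNG oddN pGN ncGN vs defG odds.
have vq := valid_quo nsNG vs; have defq := gens_quo nsNG defG.
have [eqco eqcq] := count_outside oddN vs.
have oddq: odd (count fst (quo N s)) by rewrite eqcq.
have [val5 _|] := ltnP 4 (valency (outside N s)).
  apply: (balanced_quo nsNG) => //; apply: balanced_2group => //.
  by rewrite valency_quo.
move=> val4 [|[y [s_y Ny pr_y nsyG]]] //.
have odd_y: odd #[y] by apply: dvdn_odd oddN; apply: order_dvdG.
have [s1 permy]: exists s1, perm_eq s (outside N s ++ (false, y) :: s1).
  have s_in: (false, y) \in [seq it <- s | it.2 \in N] by rewrite mem_filter Ny.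
  exists (rem (false, y) [seq it <- s | it.2 \in N]).
  apply: (perm_trans (perm_outside N s)); rewrite perm_cat2l.
  exact: perm_to_rem.
have inv_out a : (true, a) \in outside N s ->
    [/\ a \in G, #[a] = 2, #[coset N a] = 2 & coset N a \in G / N].
  rewrite mem_filter => /andP[/= nNa s_a].
  have /andP[/= Ga /eqP oa] := allP vs _ s_a.
  by rewrite (order2_coset nsNG) ?mem_quotient.
have pair_out a x : (true, a) \in outside N s -> (false, x) \in outside N s ->
    gens (quo N s) = [set coset N a; coset N x] ->
    balanced (G / N) [:: (true, coset N a); (false, coset N x)].
  move=> out_a out_x defg; have [Ga oa oa' Pa] := inv_out a out_a.
  have /andP[/= Px ntx] : (coset N x \in G / N) && (coset N x != 1).
    exact: (allP vq _ (map_f (fun it => (it.1, coset N it.2)) out_x)).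
  apply: (balanced_involution_pair _ pGN) => //; apply/orP; right.
  apply: contra ncGN => ina; apply: cyclicS (cycle_cyclic (coset N x)).
  by rewrite /= -defq defg gen_subG subUset !sub1set ina cycle_id.
have oddo: odd (count fst (outside N s)) by rewrite eqco.
have [a defs|a x defs|a x defs|a b c defs] := small_items val4 oddo.
- case/negP: ncGN; rewrite -defq /quo defs /=.
  have -> : gens [:: (true, coset N a)] = [set coset N a].
    by apply/setP=> z; rewrite !inE.
  exact: cycle_cyclic.
- apply: (balanced_quo nsNG) => //; rewrite /quo defs; apply: pair_out.
  + by rewrite defs mem_head.
  + by rewrite defs !inE eqxx orbT.
  + by rewrite /quo defs; apply/setP=> z; rewrite !inE.
- apply: (balanced_quo nsNG) => //; rewrite /quo defs /=.
  apply: (@boundary_perm _ _ [:: (true, coset N a); (false, coset N x)]).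
    by rewrite (perm_catC [:: _] [:: _]).
  apply: pair_out.
  + by rewrite defs !inE eqxx orbT.
  + by rewrite defs mem_head.
  + by rewrite /quo defs; apply/setP=> z; rewrite !inE orbC.
have [Ga oa oa' Pa] : [/\ a \in G, #[a] = 2, #[coset N a] = 2 & coset N a \in G / N].
  by apply: inv_out; rewrite defs mem_head.
have [Gb ob ob' Pb] : [/\ b \in G, #[b] = 2, #[coset N b] = 2 & coset N b \in G / N].
  by apply: inv_out; rewrite defs !inE eqxx orbT.
have [Gc oc oc' Pc] : [/\ c \in G, #[c] = 2, #[coset N c] = 2 & coset N c \in G / N].
  by apply: inv_out; rewrite defs !inE eqxx !orbT.
have defP: <<[set coset N a; coset N b; coset N c]>> = (G / N)%G.
  rewrite -[RHS]defq /quo defs; congr <<_>>.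
  by apply/setP=> z; rewrite !inE -orbA.
have fin u v w : perm_eq [:: (true, a); (true, b); (true, c)]
      [:: (true, u); (true, v); (true, w)] ->
    balanced G [:: (true, u); (true, v); (true, w); (false, y)] -> balanced G s.
  move=> perm3 bal; apply: (@balanced_sub _ G s _ s1 _ vs odds _ bal) => //.
  apply: (perm_trans permy); rewrite defs -[_ :: s1]cat1s catA.
  by rewrite perm_cat2r (perm_cat2r [:: _] [:: _; _; _] [:: _; _; _]).
have [[chi homP /and3P[ca cb cc]]|dih|dih|dih] := three_involutions pGN oa' ob' oc' defP.
- apply: (balanced_quo nsNG) => //; rewrite /quo defs.
  apply: (balanced_hom2 _ homP) => [/=|]; last by rewrite /valency !big_cons big_nil.
  by rewrite Pa Pb Pc ca cb cc.
- by apply: (fin a b c) (balanced_dihedral_quotient nsNG _ _ _ _ _ _ _ _ _ dih _ _ _ _).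
- apply: (fin a c b) (balanced_dihedral_quotient nsNG _ _ _ _ _ _ _ _ _ dih _ _ _ _) => //.
  by rewrite perm_cons (perm_catC [:: _] [:: _]).
- apply: (fin b c a) (balanced_dihedral_quotient nsNG _ _ _ _ _ _ _ _ _ dih _ _ _ _) => //.
  by rewrite (perm_catC [:: _] [:: _; _]).
Qed.

End Quotients.

(** * Supersolvable groups *)

(** All chief factors have prime order, stated so that minimal steps can be taken above any given
    normal subgroup. *)
Definition prime_chief (gT : finGroupType) (G : {group gT}) : Prop :=
  forall L N : {group gT}, L <| G -> N <| G -> L \proper N ->
  exists M : {group gT}, [/\ M <| G, L \proper M, M \subset N & prime #|M : L|].

Section Supersolvable.

Variable gT : finGroupType.
Implicit Types (G N L M H K : {group gT}).

(** The image of [N :&: K] in [G / L] is nontrivial, and cyclic because [N :&: H] is contained in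
    [L]. Its subgroup of prime order is characteristic in it, hence normal in [G / L]; [M] is the
    preimage. *)
Lemma prime_chief_step G H K L N : H <| G -> K <| G -> L <| G -> N <| G ->
    cyclic (K / H) -> N :&: H \subset L -> ~~ (N :&: K \subset L) -> L \subset N ->
  exists M : {group gT}, [/\ M <| G, L \proper M, M \subset N & prime #|M : L|].
Proof.
move=> nsHG nsKG nsLG nsNG cycKH sNHL nsNKL sLN.
pose A := (N :&: K)%G; have nsAG: A <| G by apply: normalI.
have nL: A \subset 'N(L) := subset_trans (normal_sub nsAG) (normal_norm nsLG).
have nH: A \subset 'N(H) := subset_trans (normal_sub nsAG) (normal_norm nsHG).
have cycA: cyclic (A / L).
  have /cyclicP[xb defA]: cyclic (A / H).
    by apply: cyclicS cycKH; apply: quotientS; apply: subsetIr.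
  have /morphimP[x Nx Ax def_x]: xb \in A / H by rewrite defA cycle_id.
  apply: cyclicS (cycle_cyclic (coset L x)); apply/subsetP=> _ /morphimP[g Lg Ag ->] /=.
  have /cycleP[i def_i]: coset H g \in <[xb]> by rewrite -defA mem_quotient.
  rewrite def_x -morphX //= in def_i.
  have [h Hh def_g] := kercoset_rcoset (subsetP nH _ Ag) (groupX i Nx) def_i.
  have Lh: h \in L.
    apply: (subsetP sNHL); rewrite inE Hh andbT.
    rewrite -[h](mulgK (x ^+ i)) -def_g groupM ?groupV ?groupX //.
      by case/setIP: Ag.
    by case/setIP: Ax.
  rewrite def_g mkerl ?ker_coset // ?groupX ?(subsetP nL) //.
  by rewrite morphX ?mem_cycle // (subsetP nL).
have ntA: A / L != 1 by rewrite -subG1 quotient_sub1.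
have [p_pr p_dv]: prime (pdiv #|A / L|) /\ pdiv #|A / L| %| #|A / L|.
  by split; rewrite ?pdiv_prime ?pdiv_dvd ?cardG_gt1.
have [x Ax ox] := Cauchy p_pr p_dv.
have nsxG: <[x]> <| G / L.
  apply: char_normal_trans (quotient_normal L nsAG).
  by rewrite sub_cyclic_char ?cycle_subG.
have [M defM sLM nsMG] := inv_quotientN nsLG nsxG.
have nLM: M \subset 'N(L) := subset_trans (normal_sub nsMG) (normal_norm nsLG).
have iM: #|M : L| = pdiv #|A / L| by rewrite -card_quotient // -defM -ox.
exists M; split=> //; last by rewrite iM.
  rewrite properE sLM /=; apply/negP=> sML; move: p_pr.
  have -> : pdiv #|A / L| = 1%N by rewrite -iM; apply/eqP; rewrite indexg_eq1.
  by [].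
rewrite -(quotientSGK nLM sLN) -defM cycle_subG.
by apply: subsetP Ax; apply: quotientS; apply: subsetIl.
Qed.

Lemma supersolvable_prime_chief G : supersolvable G -> prime_chief G.
Proof.
case=> t [allt patht lastt] L N nsLG nsNG /andP[sLN nsNL].
have: N :&: 1%G \subset L by rewrite setIg1 sub1G.
have: 1%G <| G by apply: normal1.
move: (1%G : {group gT}) patht lastt => H; elim: t H allt => [|K t IHt] H /=.
  move=> _ _ -> _; rewrite (setIidPl (normal_sub nsNG)) => sNL.
  by rewrite sNL in nsNL.
case/andP=> nsKG allt /andP[/andP[sHK cycKH] patht] lastt nsHG sNHL.
have [sNKL|nsNKL] := boolP (N :&: K \subset L); first exact: IHt lastt nsKG sNKL.
exact: prime_chief_step nsHG nsKG nsLG nsNG cycKH sNHL nsNKL sLN.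
Qed.

Lemma prime_chief_quotient G N : N <| G -> prime_chief G -> prime_chief (G / N)%G.
Proof.
move=> nsNG chG Lb Kb nsL nsK ltLK.
have [L defL sNL nsLG] := inv_quotientN nsNG nsL.
have [K defK sNK nsKG] := inv_quotientN nsNG nsK.
have nN := normal_norm nsNG; have sG := subset_trans _ nN.
have nNL : L \subset 'N(N) by apply: sG; apply: normal_sub.
have nNK : K \subset 'N(N) by apply: sG; apply: normal_sub.
have: L \proper K.
  by move: ltLK; rewrite !properE defL defK !quotientSGK.
case/(chG L K nsLG nsKG) => M [nsMG ltLM sMK prML].
have nNM : M \subset 'N(N) by apply: sG; apply: normal_sub.
have sNM : N \subset M := subset_trans sNL (proper_sub ltLM).
exists (M / N)%G; split; rewrite /= ?defL ?defK.
- exact: quotient_normal.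
- by move: ltLM; rewrite !properE !quotientSGK.
- exact: quotientS.
rewrite index_quotient_eq ?(proper_sub ltLM) //.
by apply: subset_trans sNL; apply: subsetIr.
Qed.

(** Otherwise a normal [M] has prime index over [L = 'O_2(G)], odd by maximality of [L]; let [t] in
    [M] have that order. Chief factors inside [L] have order 2, so they are central and [t]
    centralises [L]. Then [<[t]>] is normal in [M], hence lies in the trivial core ['O_2^'(G)]. *)
Lemma prime_chief_2group G : prime_chief G -> 'O_2^'(G) = 1 -> 2.-group G.
Proof.
move=> chG O1; pose L := 'O_2(G)%G.
have nsLG: L <| G by apply: pcore_normal.
have pL: 2.-group L by apply: pcore_pgroup.
have [sGL|nsGL] := boolP (G \subset L); first exact: pgroupS sGL pL.
have ltLG: L \proper G by rewrite properE normal_sub.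
have [M [nsMG /andP[sLM nsML] sMG prML]] := chG L G nsLG (normal_refl G) ltLG.
have nLM: M \subset 'N(L) := subset_trans sMG (normal_norm nsLG).
have cML: #|M| = (#|L| * #|M : L|)%N by rewrite Lagrange.
have odd_iM: odd #|M : L|.
  case: (even_prime prML) => // iM2; case/negP: nsML.
  apply: pcore_max nsMG; rewrite /pgroup cML pnatM [2.-nat _]pL iM2 /=.
  by rewrite pnat_id.
have [t Mt ot] : {t | t \in M & #[t] = #|M : L|}.
  by apply: Cauchy => //; rewrite cML dvdn_mull.
have odd_t: odd #|<[t]>| by rewrite -orderE ot.
have Gt: t \in G by apply: subsetP sMG _ Mt.
have co2 (D : {group gT}) : 2.-group D -> coprime #|D| #|<[t]>|.
  by move=> pD; apply: (pnat_coprime pD); rewrite -odd_2'nat.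
pose gP (D : {group gT}) := [&& D <| G, D \subset L & D \subset 'C(<[t]>)].
have gP1: gP 1%G by rewrite /gP normal1 !sub1G.
have [D maxD _] := maxgroup_exists gP1.
have /and3P[nsDG sDL cDt] := maxgroupp maxD.
have sLD: L \subset D.
  apply/idPn=> nsLD; have ltDL: D \proper L by rewrite properE sDL.
  have [D' [nsD'G ltDD' sD'L prD']] := chG D L nsDG nsLG ltDL.
  have sDD' := proper_sub ltDD'; have pD' := pgroupS sD'L pL.
  have nDG := normal_norm nsDG; have nDD' := subset_trans (normal_sub nsD'G) nDG.
  have iD2: #|D' : D| = 2.
    have: 2.-nat #|D' : D| by apply: pnat_dvd (dvdn_indexg _ _) pD'.
    by rewrite pnatE // => /eqP.
  have cQ: D' / D \subset 'C(G / D).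
    have /cyclicP[u defQ]: cyclic (D' / D) by rewrite prime_cyclic ?card_quotient.
    have ou: #[u] = 2 by rewrite orderE -defQ card_quotient.
    rewrite defQ cycle_subG; apply/centP=> g Gg; apply/commgP/conjg_fixP.
    apply: (@cycle_involution_eq _ u); rewrite ?cycle_id ?orderJ //.
    have /andP[_ /subsetP/(_ g Gg)/normP nQg] := quotient_normal D nsD'G.
    have: u ^ g \in (D' / D) :^ g by rewrite memJ_conjg defQ cycle_id.
    by rewrite nQg defQ.
  have stG: <[t]> \subset G by rewrite cycle_subG.
  have pD := pgroupS sDL pL.
  (* Coprime action lifts the centraliser of [t] in [D' / D] to [D'], so [t] centralises [D'],
     against the maximality of [D]. *)
  have eqC := coprime_norm_quotient_cent (subset_trans stG (normal_norm nsD'G))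
    (subset_trans stG nDG) (co2 D pD) (pgroup_sol pD).
  have sQC: D' / D \subset 'C_D'(<[t]>) / D.
    rewrite eqC subsetI subxx /=; apply: subset_trans cQ _; apply: centS.
    exact: quotientS.
  rewrite quotientSGK ?subsetI ?sDD' // in sQC.
  have gPD' : gP D' by rewrite /gP nsD'G sD'L; case/andP: sQC.
  have /maxgroupP[_ /(_ D' gPD' sDD') eqD] := maxD.
  by move: ltDD'; rewrite eqD properxx.
have cLt: L \subset 'C(<[t]>) := subset_trans sLD cDt.
have tiLt: L :&: <[t]> = 1 by apply: coprime_TIg; apply: co2.
have defM: L * <[t]> = M.
  apply/eqP; rewrite eqEcard mul_subG ?cycle_subG //= TI_cardMg // cML.
  by rewrite -orderE ot.
have nstM: <[t]> <| M.
  rewrite /normal cycle_subG Mt -defM mul_subG ?normG //.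
  exact: subset_trans cLt (cent_sub _).
have st: <[t]> \subset 'O_2^'(G).
  have pt: 2^'.-group <[t]> by rewrite /pgroup -odd_2'nat.
  apply: subset_trans (pcore_max pt nstM) _.
  apply: pcore_max (pcore_pgroup _ _) _.
  exact: char_normal_trans (pcore_char _ _) nsMG.
move: prML; rewrite -ot; suff -> : t = 1 by rewrite order1.
by apply/eqP; rewrite -cycle_eq1 -subG1 -O1.
Qed.

End Supersolvable.

Lemma prime_chief_pcore (gT : finGroupType) (G : {group gT}) :
  prime_chief G -> 2.-group (G / 'O_2^'(G)).
Proof.
move=> chG; have nsOG: 'O_2^'(G)%G <| G := pcore_normal _ _.
apply: (@prime_chief_2group _ (G / 'O_2^'(G))%G).
  exact: (prime_chief_quotient nsOG).
exact: trivg_pcore_quotient.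
Qed.

(** If some item lies in [N], take a normal [L] inside [N] maximal among those missing such an item.
    The next step [M] above [L] contains all items in [N], so in [G / L] a missed item generates
    [M / L], normal of prime order, and [balanced_core] applies there. *)
Lemma balanced_prime_chief (gT : finGroupType) (G N : {group gT}) s :
    prime_chief G -> N <| G -> odd #|N| ->
    2.-group (G / N) -> ~~ cyclic (G / N) ->
    valid G s -> <<gens s>> = G -> odd (count fst s) -> 4 < valency s ->
  balanced G s.
Proof.
move=> chG nsNG oddN pGN ncGN vs defG odds val5.
have [noN|] := boolP (all (fun it => it.2 \notin N) s).
  apply: (balanced_core nsNG) => //; left.
  by rewrite /outside (all_filterP noN).
rewrite -has_predC => /hasP[it0 s_it0 /= /negbNE Nit0].
pose bad (L : {group gT}) :=
  [&& L <| G, L \subset N & has (fun it => (it.2 \in N) && (it.2 \notin L)) s].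
have pairN it : it \in s -> it.2 \in N -> it.1 = false /\ it.2 != 1.
  move=> s_it Nit; have /andP[_] := allP vs it s_it.
  case: it.1 => [/eqP oit|] //; by rewrite (negPf (odd_order2 oddN oit)) in Nit.
have bad1: bad 1%G.
  rewrite /bad normal1 sub1G /=; apply/hasP; exists it0 => //.
  by rewrite Nit0 inE; have [_ ->] := pairN it0 s_it0 Nit0.
have [L maxL _] := maxgroup_exists bad1.
have /and3P[nsLG sLN /hasP[[b y] s_y /= /andP[Ny nLy0]]] := maxgroupp maxL.
have {b}s_y: (false, y) \in s by have [/= <- _] := pairN _ s_y Ny.
have ltLN: L \proper N by rewrite properE sLN; apply/subsetPn; exists y.
have [M [nsMG ltLM sMN prML]] := chG L N nsLG nsNG ltLN.
have NM it : it \in s -> it.2 \in N -> it.2 \in M.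
  move=> s_it Nit; apply/idPn=> nMit.
  have badM: bad M.
    by rewrite /bad nsMG sMN; apply/hasP; exists it => //; rewrite Nit.
  have /maxgroupP[_ /(_ M badM (proper_sub ltLM)) eqML] := maxL.
  by move: ltLM; rewrite eqML properxx.
have oddL: odd #|L| := dvdn_odd (cardSg sLN) oddN.
have [_ eqcq] := count_outside oddL vs.
have iso := third_isog sLN nsLG nsNG.
have nLG := normal_norm nsLG.
have nLM: M \subset 'N(L) := subset_trans (normal_sub nsMG) nLG.
have nLy: y \in 'N(L) by rewrite (subsetP nLM) // (NM _ s_y).
apply: (balanced_quo nsLG) => //.
apply: (@balanced_core _ (G / L)%G (N / L)%G).
- exact: quotient_normal.
- by apply: dvdn_odd oddN; apply: dvdn_quotient.
- by rewrite /pgroup (card_isog iso).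
- by rewrite (isog_cyclic iso).
- exact: valid_quo.
- exact: gens_quo.
- by rewrite eqcq.
right; exists (coset L y).
have Qy: coset L y \in M / L by rewrite mem_quotient // (NM _ s_y).
have oQ: #|M / L| = #|M : L| by rewrite card_quotient.
have oy: #[coset L y] = #|M : L|.
  apply/prime_nt_dvdP => //; last by rewrite -oQ order_dvdG.
  by rewrite order_eq1; apply: contra nLy0 => /eqP/coset_idr->.
have defM: <[coset L y]> = M / L.
  by apply/eqP; rewrite eqEcard cycle_subG Qy oQ -orderE oy leqnn.
split; rewrite ?oy ?defM ?quotient_normal ?mem_quotient //.
by apply/mapP; exists (false, y) => //; rewrite mem_filter nLy0.
Qed.

(** * Flows on Cayley graphs *)

Section Totals.

Variables (V : finType) (m : V -> V -> nat) (T : V -> V -> 'F_3).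
Hypothesis T_antisym : forall u w, T w u = (- T u w)%R.
Hypothesis T0 : forall u w, m u w = 0 -> T u w = 0%R.
Hypothesis T1 : forall u w, m u w = 1%N -> T u w <> 0%R.
Hypothesis T_sum : forall v, (\sum_w T v w = 0)%R.

(* The number of parallel edges that get the value -1. *)
Let negs u w : nat := (T u w - (m u w)%:R)%R.

(** With [r] values -1 among [n] the sum is [n - 2r], which is [n + r] mod 3; so [r] is the residue
    of [T u w - n]. It is at most [n]: clear for [n] at least 2, and ensured by [T1] and [T0] for
    [n] equal to 1 and 0. *)
Lemma sum_negs u w : (\sum_(k < m u w) sg (k < negs u w)%N = T u w)%R.
Proof.
have sumE n r : r <= n -> (\sum_(k < n) sg (k < r)%N = n%:R + r%:R :> 'F_3)%R.
  move=> le_rn; rewrite -(big_mkord xpredT (fun k => sg (k < r))).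
  rewrite (big_cat_nat (n := r)) //= [X in (X + _)%R](eq_big_nat _ _ (F2 := fun=> - 1)%R).
    rewrite [X in (_ + X)%R](eq_big_nat _ _ (F2 := fun=> 1)%R).
      rewrite !big_const_nat !iter_addr_0 subn0 mulrnBr // mulNrn.
      have := mulrn3_F3 (r%:R : 'F_3)%R; rewrite !mulrS mulr0n addr0 => r3.
      by rewrite -[RHS]subr0 -r3; ring.
    by move=> k /andP[lerk _]; rewrite ltnNge lerk.
  by move=> k /andP[_ ltkr]; rewrite ltkr.
rewrite sumE /negs; last first.
  have := T0 (u := u) (w := w); have := T1 (u := u) (w := w).
  case: (m u w) => [|[|n]].
  - by move=> _ ->.
  - move=> /(_ erefl) n0 _; move: n0; case: (T u w) => [[|[|[|]]]] //= i n0.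
    by case: n0; apply/val_inj.
  - by move=> _ _; case: (T u w - _)%R => [[|[|[|]]]].
by rewrite natr_Zp subrKC.
Qed.

Let Gamma := multigraph_of_mult m.

Let tl (e : edge Gamma) : vertex Gamma := (val (tag e)).1.
Let hd (e : edge Gamma) : vertex Gamma := (val (tag e)).2.
Let psi (e : edge Gamma) : int :=
  if tagged e < negs (val (tag e)).1 (val (tag e)).2 then (-1)%R else 1%R.

Lemma sum_edges (P : pred (V * V)) :
  ((\sum_(e : edge Gamma | P (val (tag e))) psi e)%:~R =
   \sum_(q | (enum_rank q.1 < enum_rank q.2)%N && P q) T q.1 q.2 :> 'F_3)%R.
Proof.
rewrite rmorph_sum /=.
rewrite (eq_bigr (fun e : edge Gamma => sg (tagged e < negs (val (tag e)).1 (val (tag e)).2))).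
  transitivity (\sum_(p : vpair V | P (val p))
     \sum_(k < m (val p).1 (val p).2) sg (k < negs (val p).1 (val p).2)%N)%R.
    rewrite (sig_big_dep (fun p : vpair V => P (val p)) (fun _ => xpredT)
      (fun p (k : 'I_(m (val p).1 (val p).2)) => sg (k < negs (val p).1 (val p).2))).
    by apply: eq_bigl => e; rewrite andbT.
  rewrite (eq_bigr (fun p : vpair V => T (val p).1 (val p).2)) => [|p _]; last exact: sum_negs.
  rewrite (big_sub_cond (fun q : V * V => enum_rank q.1 < enum_rank q.2) P (fun q => T q.1 q.2)).
  by [].
by move=> e _; rewrite /psi /sg; case: (_ < _).
Qed.

Lemma has_flow_of_totals : has_nowhere_zero_flow 3 Gamma.
Proof.
have TD u : T u u = 0%R.
  have := T_antisym u u; move: (T u u) => x.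
  by case: x => [[|[|[|]]]] // i E; apply/val_inj => //=; move/(congr1 val): E.
have fl: mod3_flow tl hd psi.
  split=> [e|v]; first by rewrite /psi; case: ifP.
  have char3: 3 \in [pchar 'F_3]%R by apply: pchar_Fp.
  suff: ((excess tl hd psi v)%:~R = 0 :> 'F_3)%R.
    move/eqP; rewrite -(dvdz_pcharf char3) => /dvdzP[k ->].
    by exists k; rewrite mulrC.
  rewrite /excess rmorphB /= (sum_edges (fun q => q.1 == v)) (sum_edges (fun q => q.2 == v)).
  have sumt : (\sum_(q : V * V | (enum_rank q.1 < enum_rank q.2)%N && (q.1 == v)) T q.1 q.2
      = \sum_(w | (enum_rank v < enum_rank w)%N) T v w)%R.
    rewrite (eq_bigl (fun q => (q.1 == v) && (enum_rank q.1 < enum_rank q.2)%N)).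
      rewrite -(pair_big_dep (pred1 v) (fun u w => (enum_rank u < enum_rank w)%N) T) /=.
      by rewrite big_pred1_eq.
    by move=> q; rewrite andbC.
  have sumh : (\sum_(q : V * V | (enum_rank q.1 < enum_rank q.2)%N && (q.2 == v)) T q.1 q.2
      = \sum_(w | (enum_rank w < enum_rank v)%N) T w v)%R.
    rewrite -(pair_big_dep xpredT (fun u w => (enum_rank u < enum_rank w)%N && (w == v)) T) /=.
    rewrite [RHS]big_mkcond; apply: eq_bigr => u _.
    case: ifP => ltuv; last first.
      by rewrite big1 // => w /andP[+ /eqP wv]; rewrite wv ltuv.
    rewrite (big_pred1 v) // => w /=.
    by case: (eqVneq w v) => [->|_]; rewrite ?ltuv ?andbF.
  rewrite sumt sumh -[RHS](T_sum v) [RHS](bigD1 v) //= TD add0r.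
  rewrite [RHS](bigID (fun w => (enum_rank v < enum_rank w)%N)) /=; congr (_ + _)%R.
    apply: eq_bigl => w; case: eqVneq => [->|] //=; by rewrite ltnn.
  rewrite -sumrN; apply: eq_big => [w|w _]; last by rewrite T_antisym opprK.
  rewrite -leqNgt [X in _ && X]leq_eqVlt (inj_eq (@ord_inj _)) (inj_eq enum_rank_inj).
  by case: eqVneq => [->|] //=; rewrite ltnn.
have [psi' [nzP _] ex0] := mod3_flow_flow fl.
have ends_tl (e : edge Gamma) : ends e = [set tl e; hd e] by [].
exists (Orientation ends_tl), psi'; split; last by move=> e; apply/eqP; case: (nzP e).
split=> [e|v]; first by case: (nzP e).
by apply/eqP; rewrite -subr_eq0; apply/eqP; apply: ex0.
Qed.

End Totals.

Section BoundaryTotals.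

Variables (gT : finGroupType) (G : {group gT}).
Implicit Types (s : seq (bool * gT)) (x g : gT).

Definition item_mult (it : bool * gT) x : nat :=
  (it.2 == x) + (if it.1 then 0 else (it.2^-1 == x)).

Definition mult s x : nat := \sum_(it <- s) item_mult it x.

(** [t g x] is the total value mod 3 leaving [g] on the [n x] parallel edges to [g * x]. It may
    vanish when there are at least two of them, since they can be assigned new signs later. *)
Definition totals (n : gT -> nat) (c : gT -> 'F_3) (t : gT -> gT -> 'F_3) : Prop :=
  {in G, forall g,
    [/\ {in G, forall x, t (g * x) x^-1 = (- t g x)%R}, (\sum_x t g x = c g)%R,
        forall x, n x = 0 -> t g x = 0%R & forall x, n x = 1%N -> t g x <> 0%R]}.

Lemma sg_neq0 b : sg b <> 0%R.
Proof. by case: b => /(congr1 val). Qed.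

Lemma item_totals (it : bool * gT) c : it.2 \in G -> (it.1 -> #[it.2] = 2) ->
  item_boundary G it c -> exists t, totals (item_mult it) c t.
Proof.
case: it => [[] a] /= Ga; rewrite /item_boundary /item_mult /=.
  move=> /(_ isT) oa [f fP]; exists (fun g x => if a == x then sg (f g) else 0%R) => g Gg.
  have [fa cg] := fP g Gg; split.
  - move=> x Gx; have -> : (a == x^-1) = (a == x) by rewrite -(inj_eq invg_inj) invgK order2V.
    by case: eqP => [<-|_]; rewrite ?oppr0 // fa sgN.
  - by rewrite -big_mkcond (big_pred1 a) // => x; rewrite eq_sym.
  - by move=> x; case: eqP.
  - by move=> x; case: eqP => // _ _; apply: sg_neq0.
move=> _ [d dP].
exists (fun g x => (if a == x then sg (d g) else 0%R) -
                   (if (a^-1)%g == x then sg (d (g * x)%g) else 0%R))%R => g Gg; split.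
- move=> x Gx; have -> : (a == x^-1) = (a^-1 == x) by rewrite -(inj_eq invg_inj) invgK.
  by rewrite mulgK (inj_eq invg_inj) opprB.
- rewrite sumrB dP // -!big_mkcond (big_pred1 a) => [|x]; last by rewrite eq_sym.
  by rewrite (big_pred1 a^-1) // => x; rewrite eq_sym.
- by move=> x; case: eqP => //; case: eqP => //; rewrite subrr.
move=> x; case: eqP => _; case: eqP => _ //= _; rewrite ?subr0 ?sub0r.
  exact: sg_neq0.
by rewrite -sgN; apply: sg_neq0.
Qed.

Lemma boundary_totals s c : valid G s -> boundary G s c ->
  exists t, totals (mult s) c t.
Proof.
rewrite /mult; elim: s c => [|it s IHs] c /=.
  move=> _ c0; exists (fun _ _ => 0%R) => g Gg; split=> [x _||//|x].
  - by rewrite oppr0.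
  - by rewrite big1 ?c0.
  - by rewrite big_nil.
case/andP=> /andP[Git oit] vs [c1 itc1 sc].
have inv_it: it.1 -> #[it.2] = 2 by case: it.1 oit => // /eqP.
have [t1 t1P] := item_totals Git inv_it itc1; have [t2 t2P] := IHs _ vs sc.
exists (fun g x => t1 g x + t2 g x)%R => g Gg.
have [a1 s1 z1 n1] := t1P g Gg; have [a2 s2 z2 n2] := t2P g Gg; split.
- by move=> x Gx; rewrite a1 // a2 // opprD.
- by rewrite big_split /= s1 s2 addrC subrK.
- move=> x; rewrite big_cons => /eqP; rewrite addn_eq0 => /andP[/eqP m1 /eqP m2].
  by rewrite z1 // z2 // addr0.
move=> x; rewrite big_cons.
case m1: (item_mult it x) => [|[|k]]; case m2: (\sum_(j <- s) _) => [|[|l]] //= _.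
  by rewrite z1 // add0r; apply: n2.
by rewrite z2 // addr0; apply: n1.
Qed.

End BoundaryTotals.

Local Open Scope mset_scope.

Section CayleyItems.

Variables (gT : finGroupType) (G : {group gT}) (X : {mset gT}).
Hypothesis connX : connection_multiset G X.

(* The enumeration of gT selects one element of each pair x, x^-1. *)
Definition items : seq (bool * gT) :=
  [seq (true, x) | x <- X & x^-1 == x] ++
  [seq (false, x) | x <- X & (enum_rank x < enum_rank x^-1)%N].

Lemma sum_eq_count (l : seq gT) (P : pred gT) x :
  \sum_(y <- l | P y) (y == x) = (if P x then count_mem x l else 0).
Proof.
elim: l => [|y l IHl]; first by rewrite big_nil; case: ifP.
by rewrite big_cons IHl /=; case: (eqVneq y x) => [->|_]; case: (P _).
Qed.

Lemma mult_items x : mult items x = X x.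
Proof.
have [_ XV] := connX.
rewrite /mult /items big_cat !big_map !big_filter /=.
under eq_bigr do rewrite /item_mult /= addn0.
rewrite sum_eq_count; under [X in (_ + X)%N]eq_bigr do rewrite /item_mult /=.
rewrite big_split /= sum_eq_count.
under [X in (_ + (_ + X))%N]eq_bigr => y _ do
  rewrite -[y^-1 == x](inj_eq invg_inj) invgK.
rewrite sum_eq_count invgK !count_mem_mset XV.
case: (eqVneq x^-1 x) => [->|nex]; first by rewrite ltnn !addn0.
case: ltngtP => //; rewrite ?addn0 // => /ord_inj/enum_rank_inj eqx.
by rewrite -eqx eqxx in nex.
Qed.

Lemma valency_items : valency items = size X.
Proof.
have sumv s : \sum_(x : gT) mult s x = valency s.
  rewrite /mult /valency exchange_big /=; apply: eq_bigr => it _.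
  rewrite /item_mult big_split /=.
  have one (y : gT) : \sum_(x : gT) (y == x) = 1%N.
    by rewrite (bigD1 y) //= eqxx big1 // => x; rewrite eq_sym => /negPf->.
  by rewrite one; case: it.1; rewrite ?one // big1.
rewrite -sumv (eq_bigr (fun x => X x)) => [|x _]; last exact: mult_items.
rewrite -sum1_size (eq_bigr (fun x => \sum_(y <- X) (y == x))) => [|x _].
  rewrite exchange_big /=; apply: eq_bigr => y _.
  by rewrite (bigD1 y) //= eqxx big1 // => x; rewrite eq_sym => /negPf->.
by rewrite (sum_eq_count _ xpredT) count_mem_mset.
Qed.

Lemma valid_items : valid G items.
Proof.
have [XG _] := connX; apply/allP=> it; rewrite mem_cat => /orP[] /mapP[x].
  rewrite mem_filter => /andP[/eqP Vx /XG]; rewrite !inE => /andP[nt1 Gx] -> /=.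
  rewrite Gx; apply/eqP; apply/prime_nt_dvdP; rewrite ?order_eq1 //.
  by rewrite order_dvdn expgS expg1 -{1}Vx mulVg.
rewrite mem_filter => /andP[_ /XG]; rewrite !inE => /andP[nt1 Gx] -> /=.
by rewrite Gx.
Qed.

Lemma mem_gen_items x : x \in X -> x \in <<gens items>>.
Proof.
have [_ XV] := connX; move=> Xx; have X1 : 0 < mult items x.
  by rewrite mult_items lt0n; apply/eqP => /mset_eq0P; rewrite Xx.
have /hasP[it s_it] : has (fun it => 0 < item_mult it x) items.
  apply: contraTT X1; rewrite -all_predC => /allP all0; rewrite -leqNgt leqn0.
  rewrite /mult big_seq big1 // => it /all0 /=; by rewrite -leqNgt leqn0 => /eqP.
have git: it.2 \in <<gens items>> by rewrite mem_gen // inE map_f.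
rewrite /item_mult; case: eqVneq => [<- //|_]; case: it.1 => //=.
by case: eqVneq => // <- _; rewrite groupV.
Qed.

Lemma gens_items : connected (Cayley G X) -> <<gens items>> = G.
Proof.
have [XG XV] := connX; move=> conG; apply/eqP; rewrite eqEsubset gen_subG; apply/andP; split.
  apply/subsetP=> x; rewrite inE => /mapP[it s_it ->].
  by have /andP[] := allP valid_items it s_it.
apply/subsetP=> g Gg.
have /connectP[p pathp def_g] := conG (subg G 1) (subg G g).
suff: sgval (last (subg G 1) p) \in <<gens items>> by rewrite -def_g subgK.
have: sgval (subg G 1) \in <<gens items>> by rewrite subgK ?group1.
move: (subg G 1) pathp => u /=; clear def_g; elim: p u => [|v p IHp] u //=.
case/andP=> adj pathp Hu; apply: IHp pathp _.
have Xuv: 0 < X (sgval (u^-1 * v)).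
  rewrite -(card_Cayley_edges u v connX) card_gt0; apply/set0Pn.
  by have /existsP[e ends_e] := adj; exists e; rewrite inE.
have Xx : sgval (u^-1 * v) \in X.
  by apply/negPn; apply/negP=> /mset_eq0P X0; rewrite X0 in Xuv.
rewrite -[v](mulKVg u) /= groupM //; exact: mem_gen_items Xx.
Qed.

Lemma balanced_Cayley_flow : balanced G items -> has_nowhere_zero_flow 3 (Cayley G X).
Proof.
case/(boundary_totals valid_items) => t tP; have [XG XV] := connX.
apply: (@has_flow_of_totals _ _ (fun u w : [subg G] => t (sgval u) (sgval (u^-1 * w)))).
- move=> u w; have [anti _ _ _] := tP _ (subgP u).
  rewrite -(anti _ (subgP (u^-1 * w))) -[sgval u * _]/(sgval (u * (u^-1 * w))) mulKVg.
  by rewrite -[_^-1 in RHS]/(sgval (u^-1 * w)^-1) invMg invgK.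
- by move=> u w X0; have [_ _ z0 _] := tP _ (subgP u); apply: z0; rewrite mult_items.
- by move=> u w X1; have [_ _ _ n1] := tP _ (subgP u); apply: n1; rewrite mult_items.
move=> v; have [_ sum0 z0 _] := tP _ (subgP v).
rewrite (reindex_inj (mulgI v)) /= -[RHS]sum0.
rewrite [RHS](bigID (mem G)) /= [X in (_ + X)%R]big1 ?addr0; last first.
  move=> x nGx; apply: z0; rewrite mult_items; apply/mset_eq0P.
  by apply: contra nGx => /XG /setD1P[].
rewrite [RHS](reindex (@sgval gT G)) /=; last first.
  exists (subg G) => x; first by rewrite sgvalK.
  by move=> Gx; rewrite subgK.
by apply: eq_big => [w|w _]; rewrite ?subgP // mulKg.
Qed.

End CayleyItems.

Theorem theorem1p2 (gT : finGroupType) (G : {group gT})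
    (supersolG : supersolvable G)
    (P : {group gT}) (sylP : 2.-Sylow(G) P) (ncycP : ~~ cyclic P)
    (X : {mset gT}) (connX : connection_multiset G X)
    (conG : connected (Cayley G X)) (valX : 4 <= size X) :
  has_nowhere_zero_flow 3 (Cayley G X).
Proof.
apply: balanced_Cayley_flow => //.
have vX := valid_items connX.
have [odds|] := boolP (odd (count fst (items X))); last first.
  apply: balanced_even; apply/allP=> it s_it; have /andP[_] := allP vX it s_it.
  by case: it.1.
have chG := supersolvable_prime_chief supersolG.
pose N := 'O_2^'(G)%G.
have pN: 2^'.-group N by apply: pcore_pgroup.
have nsNG: N <| G by apply: pcore_normal.
have [sPG pP _] := and3P sylP.
apply: (@balanced_prime_chief _ G N) => //.
- by rewrite odd_2'nat.
- exact: prime_chief_pcore.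
(* [P] meets the odd group [N] trivially, so it embeds in [G / N]. *)
- apply: contra ncycP => cycGN.
  have tiP: N :&: P = 1 by rewrite setIC coprime_TIg // (pnat_coprime pP).
  have nNP: P \subset 'N(N) := subset_trans sPG (normal_norm nsNG).
  rewrite (isog_cyclic (quotient_isog nNP tiP)).
  exact: cyclicS (quotientS _ sPG) cycGN.
- exact: gens_items.
(* The valency has the parity of the number of involutions, here odd, so it cannot be 4 and is at
   least 5. *)
have even_val s : odd (valency s) = odd (count fst s).
  elim: s => [|it s IHs]; first by rewrite /valency big_nil.
  by rewrite valency_cons /= !oddD IHs; case: it.1.
rewrite ltn_neqAle (valency_items connX) valX andbT; apply: contraTneq odds => val4.
by rewrite -even_val (valency_items connX) -val4.
Qed.
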